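(* Let $d,N\in\mathbb{N}$ with $d\ge2$ and $\rho\in[0,\infty)$. Let $X=(X_j)_{j=1}^N$ be a $\mathcal{D}_0^d$-$e^{\rho d}$-negatively dependent sampling scheme in $[0,1)^d$. Then for every $c>2.4968$, $$D_N^*(X)\le c\sqrt{\frac{d}{N}}$$ holds with probability at least $1-e^{-(1.67681c^2-10.45292-\rho)\cdot d}$. Consequently, for every $q\in(0,1)$, $$D_N^*(X)\le 0.7723\sqrt{10.45292+\rho+\frac{\log((1-q)^{-1})}{d}}\sqrt{\frac{d}{N}}$$ holds with probability at least $q$.
   Context: $\log$ is the natural logarithm and $\lambda_d$ Lebesgue measure. For an $N$-point set (sequence) $P=(p_1,\dots,p_N)$ in $[0,1)^d$, its star-discrepancy is $D_N^*(P):=\sup_{a\in[0,1]^d}\left|\frac1N|\{j: p_j\in[0,a)\}|-\lambda_d([0,a))\right|$, where $[0,a)=[0,a_1)\times\cdots\times[0,a_d)$. A sampling scheme is a random $N$-tuple $(p_1,\dots,p_N)$ of points in $[0,1)^d$ such that each $p_j$ is uniformly distributed in $[0,1)^d$ and the vector is exchangeable (its distribution is invariant under every permutation of the indices). For $\gamma\ge1$, binary random variables $T_1,\dots,T_N$ are $\gamma$-negatively dependent if for all $u\subseteq\{1,\dots,N\}$: $\mathbb{P}(\bigcap_{j\in u}\{T_j=1\})\le\gamma\prod_{j\in u}\mathbb{P}(T_j=1)$ and $\mathbb{P}(\bigcap_{j\in u}\{T_j=0\})\le\gamma\prod_{j\in u}\mathbb{P}(T_j=0)$. Let $\mathcal{C}_0^d:=\{[0,a):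 a\in[0,1)^d\}$ and $\mathcal{D}_0^d:=\{Q\setminus R: Q,R\in\mathcal{C}_0^d\}$. A sampling scheme $(p_j)_{j=1}^N$ is $\mathcal{D}_0^d$-$\gamma$-negatively dependent if for every $Q\in\mathcal{D}_0^d$ the random variables $(\mathbf{1}_Q(p_j))_{j=1}^N$ are $\gamma$-negatively dependent. *)

(* Defs.v *)
From HB Require Import structures.
From mathcomp Require Import all_boot all_order all_algebra all_fingroup.
From mathcomp Require Import all_classical all_reals all_analysis.

Set Implicit Arguments.
Unset Strict Implicit.
Unset Printing Implicit Defensive.

Import Order.TTheory GRing.Theory Num.Theory.
Import numFieldNormedType.Exports.

Local Open Scope classical_set_scope.
Local Open Scope ring_scope.

Section cons_measure.
Context {R : realType} {disp : measure_display} {T : measurableType disp}.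
Variable n : nat.

Definition tcons (x : T * n.-tuple T) : n.+1.-tuple T := [tuple of x.1 :: x.2].

Lemma measurable_tcons : measurable_fun setT tcons.
Proof. exact: measurable_cons. Qed.

Variables (m1 : {sigma_finite_measure set T -> \bar R})
          (m2 : {sigma_finite_measure set (n.-tuple T) -> \bar R}).

Definition cons_measure : set (n.+1.-tuple T) -> \bar R :=
  pushforward (m1 \x m2)%E tcons.

Let cons_measure0 : cons_measure set0 = 0%E.
Proof. by rewrite /cons_measure /pushforward preimage_set0 measure0. Qed.

Let cons_measure_ge0 A : (0 <= cons_measure A)%E.
Proof. by rewrite /cons_measure /pushforward; exact: measure_ge0. Qed.

Let cons_measure_sigma_additive : semi_sigma_additive cons_measure.
Proof.
move=> F mF tF mUF; rewrite /cons_measure /pushforward preimage_bigcup.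
apply: measure_semi_sigma_additive.
- by move=> k; rewrite -[X in measurable X]setTI; exact: measurable_tcons.
- apply/trivIsetP => /= i j _ _ ij; rewrite -preimage_setI.
  by move/trivIsetP : tF => /(_ _ _ _ _ ij) ->//; rewrite preimage_set0.
- by rewrite -preimage_bigcup -[X in measurable X]setTI; exact: measurable_tcons.
Qed.

HB.instance Definition _ := isMeasure.Build _ _ _ cons_measure
  cons_measure0 cons_measure_ge0 cons_measure_sigma_additive.

Let cons_measure_sigma_finite : sigma_finite setT cons_measure.
Proof.
have /sigma_finiteP[F [TF ndF mF]] := sigma_finiteT m1.
have /sigma_finiteP[G [TG ndG mG]] := sigma_finiteT m2.
pose g (y : n.+1.-tuple T) : T * n.-tuple T := (thead y, [tuple of behead y]).
have gK : cancel g tcons by move=> y; rewrite /tcons /= -tuple_eta.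
have tK : cancel tcons g.
  by case=> a b; rewrite /g /= theadE; congr pair; exact: val_inj.
have mg : measurable_fun setT g.
  by apply: measurable_fun_pair;
    [exact: measurable_tnth|exact: measurable_behead].
exists (fun k => g @^-1` (F k `*` G k)).
  apply/seteqP; split=> // y _.
  have : [set: _] (g y).1 by [].
  rewrite TF => -[i _ Fi].
  have : [set: _] (g y).2 by [].
  rewrite TG => -[j _ Gj].
  exists (maxn i j) => //; split.
  - by move: Fi; exact/subsetPset/ndF/leq_maxl.
  - by move: Gj; exact/subsetPset/ndG/leq_maxr.
move=> k; have [mFk Fk] := mF k; have [mGk Gk] := mG k; split.
  by rewrite -[X in measurable X]setTI; apply: mg => //; exact: measurableX.
rewrite /cons_measure /pushforward -comp_preimage.
rewrite (_ : g \o tcons = id)/=; last by apply/funext => x /=; rewrite tK.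
by rewrite product_measure1E// lte_mul_pinfty// ge0_fin_numE.
Qed.

HB.instance Definition _ := Measure_isSigmaFinite.Build _ _ _ cons_measure
  cons_measure_sigma_finite.

End cons_measure.

Section lebesgue_tuple.
Context {R : realType}.
Local Open Scope ereal_scope.

(* [lebesgue_measure] lives on [measurableTypeR R]; this is the same set function
   on [R] with its canonical (identical) Borel sigma-algebra. *)
Definition lebesgueR : set R -> \bar R := lebesgue_measure.

Let lebesgueR0 : lebesgueR set0 = 0.
Proof. exact: (measure0 (@lebesgue_measure R)). Qed.

Let lebesgueR_ge0 A : 0 <= lebesgueR A.
Proof. exact: (measure_ge0 (@lebesgue_measure R)). Qed.

Let lebesgueR_sigma_additive : semi_sigma_additive lebesgueR.
Proof. exact: (@measure_semi_sigma_additive _ _ _ (@lebesgue_measure R)). Qed.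

HB.instance Definition _ := isMeasure.Build _ _ _ lebesgueR
  lebesgueR0 lebesgueR_ge0 lebesgueR_sigma_additive.

Let lebesgueR_sigma_finite : sigma_finite setT lebesgueR.
Proof. exact: (sigma_finiteT (@lebesgue_measure R)). Qed.

HB.instance Definition _ := Measure_isSigmaFinite.Build _ _ _ lebesgueR
  lebesgueR_sigma_finite.

Fixpoint lebesgue_tuple (d : nat) :
    {sigma_finite_measure set (d.-tuple R) -> \bar R} :=
  match d with
  | 0 => \d_ ([tuple] : 0.-tuple R)
  | n.+1 => cons_measure lebesgueR (lebesgue_tuple n)
  end.

End lebesgue_tuple.

Lemma lebesgue_tuple_itv {R : realType} d (a b : d.-tuple R) :
  (forall i, tnth a i <= tnth b i) ->
  lebesgue_tuple d [set x | forall i, tnth a i <= tnth x i < tnth b i] =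
  (\prod_(i < d) (tnth b i - tnth a i))%:E.
Proof.
elim: d a b => [|n IH] a b ab.
  by rewrite big_ord0 /= diracE mem_set//= => -[].
rewrite /= /cons_measure /pushforward.
pose a' : n.-tuple R := [tuple tnth a (lift ord0 i) | i < n].
pose b' : n.-tuple R := [tuple tnth b (lift ord0 i) | i < n].
rewrite (_ : _ @^-1` _ = `[tnth a ord0, tnth b ord0[%classic `*`
   [set x : n.-tuple R | forall i, tnth a' i <= tnth x i < tnth b' i]).
  have mbox : measurable
      [set x : n.-tuple R | forall i, tnth a' i <= tnth x i < tnth b' i].
    rewrite (_ : [set x | _] = \bigcap_(i in [set: 'I_n])
        ((@tnth n R)^~ i @^-1` `[tnth a' i, tnth b' i[%classic)); last first.
      apply/seteqP; split=> x /= h i; first by move=> _; rewrite /= in_itv /= h.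
      by have := h i I; rewrite /= in_itv.
    apply: fin_bigcap_measurable => // i _; rewrite -[X in measurable X]setTI.
    exact: (@measurable_tnth _ _ _ i measurableT _ (measurable_itv _)).
  rewrite (product_measure1E _ _ (measurable_itv _) mbox).
  rewrite IH; last by move=> i; rewrite !tnth_mktuple.
  have Hl : (@lebesgueR R `[tnth a ord0, tnth b ord0[%classic =
      if (tnth a ord0 < tnth b ord0)%R
      then (tnth b ord0)%:E - (tnth a ord0)%:E else 0)%E.
    by rewrite /lebesgueR lebesgue_measure_itv /= lte_fin.
  apply: (eq_trans (congr1 (fun z => (z * _)%E) Hl)).
  rewrite big_ord_recl
    (eq_bigr (fun i => tnth b (lift ord0 i) - tnth a (lift ord0 i))); last first.
    by move=> i _; rewrite !tnth_mktuple.
  case: ltP => h; first by rewrite EFinM -EFinB.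
  have -> : tnth b ord0 = tnth a ord0 by apply/le_anti; rewrite h ab.
  by rewrite subrr !mul0r mul0e.
apply/seteqP; split=> -[x y] /=.
  move=> h; split; first by rewrite /= in_itv /=; have := h ord0; rewrite (tnth_nth 0).
  move=> i; rewrite !tnth_mktuple; have := h (lift ord0 i).
  by rewrite /tcons /= tnthS.
move=> [h1 h2] i; case: (unliftP ord0 i) => [j|] ->.
  by have := h2 j; rewrite !tnth_mktuple /tcons /= tnthS.
by move: h1; rewrite /= in_itv /=.
Qed.

Section star_discrepancy.
Context {R : realType}.
Local Open Scope ereal_scope.
Variable d : nat.

Definition unit_cube : set (d.-tuple R) :=
  [set x | forall i, (0 <= tnth x i < 1)%R].

Definition closed_unit_cube : set (d.-tuple R) :=
  [set x | forall i, (0 <= tnth x i <= 1)%R].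

Definition anchored_box (a : d.-tuple R) : set (d.-tuple R) :=
  [set x | forall i, (0 <= tnth x i < tnth a i)%R].

Definition anchored_boxes : set (set (d.-tuple R)) :=
  [set anchored_box a | a in unit_cube].

Definition anchored_box_diffs : set (set (d.-tuple R)) :=
  [set Q1 `\` Q2 | Q1 in anchored_boxes & Q2 in anchored_boxes].

Definition star_discrepancy (N : nat) (p : N.-tuple (d.-tuple R)) : R :=
  sup [set `| #|[pred j : 'I_N | tnth p j \in anchored_box a]|%:R / N%:R
              - fine (lebesgue_tuple d (anchored_box a)) |%R
      | a in closed_unit_cube].

End star_discrepancy.
Arguments unit_cube {R d}.
Arguments closed_unit_cube {R d}.
Arguments anchored_boxes {R d}.
Arguments anchored_box_diffs {R d}.

Section sampling.
Context {R : realType} {disp : measure_display} {Omega : measurableType disp}.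
Variables (P : probability Omega R) (N : nat).
Local Open Scope ereal_scope.

(* A binary random variable is a [bool]-valued function: true is 1, false is 0. *)
Definition negatively_dependent (gamma : R) (T : 'I_N -> Omega -> bool) :=
  forall u : {set 'I_N},
    P (\bigcap_(j in [set` u]) [set w | T j w = true])
      <= gamma%:E * \prod_(j in u) P [set w | T j w = true] /\
    P (\bigcap_(j in [set` u]) [set w | T j w = false])
      <= gamma%:E * \prod_(j in u) P [set w | T j w = false].

Variables (d : nat) (X : {RV P >-> N.-tuple (d.-tuple R)}).

Definition uniform_marginals := forall (j : 'I_N) (A : set (d.-tuple R)),
  measurable A ->
  P [set w | A (tnth (X w) j)] = lebesgue_tuple d (A `&` unit_cube).

Definition exchangeable := forall (s : {perm 'I_N})
    (A : set (N.-tuple (d.-tuple R))), measurable A ->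
  P [set w | A [tuple tnth (X w) (s j) | j < N]] = P [set w | A (X w)].

Definition sampling_scheme :=
  [/\ forall w j, unit_cube (tnth (X w) j), uniform_marginals & exchangeable].

Definition D0_negatively_dependent (gamma : R) :=
  forall Q, anchored_box_diffs Q ->
    negatively_dependent gamma (fun j w => tnth (X w) j \in Q).

End sampling.

(* Main.v *)
(** The deviation of the empirical measure is controlled by chaining.  A net
    for the accuracy [delta] consists of the points [(q^(n_1), ..., q^(n_d))]
    with bounded [n_1 + ... + n_d]: rounding the logarithms of the coordinates
    of a box changes its volume by a constant factor, so that boxes of volume
    about [v] only need the step [q^(-d) = 1 + delta / v].  Counting lattice
    points in a simplex bounds the size of such a net by
    [2 e^(d-2) (5/2 + M (1 + v / delta))^d], where [e^(-M)] is the smallest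
    volume treated.  For the coarsest net, of accuracy [10^(-4)], the boxes are
    split into three layers according to their volume, which avoids the factor
    [M^d]; the nets of accuracy [10^(-4 (k+1))], [k >= 1], use a single layer.

    Expanding [prod_j (1 + (e^x - 1) T_j)] over subsets shows that negative
    dependence bounds the moment generating function of the number of hits by
    [gamma] times that of independent indicators.  This yields a Hoeffding bound
    for the boxes of the coarsest net and a Bernstein bound for the set
    differences linking consecutive nets, whose measure is at most the accuracy
    of the coarser one.  With [s = sqrt (d / N)] the deviations allowed are
    [.928 c s] for the coarsest net and [.032 5^(-k) c s] for the [k]-th step;
    the chain stops once the accuracy is below [.032 c s], and
    [.928 + .04 + .032 = 1]. *)

Require Import Defs.
From HB Require Import structures.
From mathcomp Require Import all_boot all_order all_algebra all_fingroup.
From mathcomp Require Import all_classical all_reals all_analysis.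
From mathcomp Require Import measurable_realfun.
From mathcomp Require Import ring lra.

Set Implicit Arguments.
Unset Strict Implicit.
Unset Printing Implicit Defensive.

Import Order.TTheory GRing.Theory Num.Theory.
Import numFieldNormedType.Exports.

Local Open Scope classical_set_scope.
Local Open Scope ring_scope.

(** * Exponential inequalities *)

Section exponential.
Context {R : realType}.
Implicit Types x p : R.

(** Applied to the difference of two sides that agree at 0, this reduces an inequality to one
    between derivatives, which can be treated in the same way. *)
Lemma ge0_of_derive (f f' : R -> R) :
  (forall x, 0 <= x -> is_derive x 1 f (f' x)) ->
  (forall x, 0 <= x -> 0 <= f' x) -> f 0 = 0 -> forall x, 0 <= x -> 0 <= f x.
Proof.
move=> df f'0 f0 x x0; rewrite -f0.
have dd y : 0 <= y -> derivable f y 1 by move=> /df [].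
apply: (@ger0_derive1_ndecry _ f 0) => //.
- by move=> y; rewrite in_itv /= andbT => /ltW/dd.
- move=> y; rewrite in_itv /= andbT => /ltW y0.
  by rewrite derive1E (@derive_val _ _ _ _ _ _ _ (df _ y0)) f'0.
- apply: derivable_within_continuous => y; rewrite in_itv /= andbT; exact: dd.
Qed.

Lemma expR_ge_quadratic x : 0 <= x -> 1 + x + x ^+ 2 / 2 <= expR x.
Proof.
move=> x0; rewrite -subr_ge0.
apply: (@ge0_of_derive (fun x => expR x - (1 + x + x ^+ 2 / 2))
  (fun x => expR x - (1 + x))) => //.
- move=> y _; apply: is_derive_eq; rewrite /GRing.scale /=; by field.
- by move=> y _; rewrite subr_ge0 expR_ge1Dx.
- by rewrite expR0; field.
Qed.

Lemma expR_ge_cubic x : 0 <= x -> 1 + x + x ^+ 2 / 2 + x ^+ 3 / 6 <= expR x.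
Proof.
move=> x0; rewrite -subr_ge0.
apply: (@ge0_of_derive (fun x => expR x - (1 + x + x ^+ 2 / 2 + x ^+ 3 / 6))
  (fun x => expR x - (1 + x + x ^+ 2 / 2))) => //.
- move=> y _; apply: is_derive_eq; rewrite /GRing.scale /=; by field.
- by move=> y y0; rewrite subr_ge0 expR_ge_quadratic.
- by rewrite expR0; field.
Qed.

(** Since (1 + x + x^2/2)(1 - x + x^2/2) = 1 + x^4/4 >= 1, the reciprocal of the quadratic lower
    bound for [expR x] is small enough. *)
Lemma expRN_le_quadratic x : 0 <= x -> expR (- x) <= 1 - x + x ^+ 2 / 2.
Proof.
move=> x0; have := expR_ge_quadratic x0 => h.
have h1 : 0 < 1 + x + x ^+ 2 / 2 by nra.
rewrite expRN; apply: (@le_trans _ _ (1 + x + x ^+ 2 / 2)^-1).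
  by rewrite lef_pV2 ?posrE ?expR_gt0.
rewrite -div1r ler_pdivrMr //; nra.
Qed.

(* Division by [1 - x / 3] gives the (2,1) Pade approximant of [expR]. *)
Lemma expR_le_pade x : 0 <= x ->
  (1 - x / 3) * expR x <= 1 + 2 / 3 * x + x ^+ 2 / 6.
Proof.
move=> x0; rewrite -subr_ge0.
apply: (@ge0_of_derive
  (fun x => 1 + 2 / 3 * x + x ^+ 2 / 6 - (1 - x / 3) * expR x)
  (fun x => 2 / 3 + x / 3 - (2 / 3 - x / 3) * expR x)) => //.
- move=> y _; apply: is_derive_eq; rewrite /GRing.scale /=; by field.
- apply: (@ge0_of_derive _ (fun x => (1 - (1 - x) * expR x) / 3)).
  + move=> y _; apply: is_derive_eq; rewrite /GRing.scale /=; by field.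
  (* The second derivative is nonnegative because 1 - y <= e^(-y). *)
  + move=> y y0; apply: divr_ge0 => //; rewrite subr_ge0.
    rewrite -[leRHS](expRxMexpNx_1 y) [leRHS]mulrC.
    by rewrite ler_wpM2r ?expR_ge0 // expR_ge1Dx.
  + by rewrite expR0; ring.
- by rewrite expR0; field.
Qed.

(** Comparison with the Pade approximant leaves the remainder x^2 (1/6 - 2x/9), which is nonnegative
    exactly up to x = 3/4. *)
Lemma expR_le_quadratic x : 0 <= x <= 3 / 4 ->
  expR x <= 1 + x + 2 / 3 * x ^+ 2.
Proof.
move=> /andP[x0 x1]; have := expR_le_pade x0.
rewrite -[_ * expR x]mulrC -ler_pdivlMr; last by lra.
move/le_trans; apply; rewrite ler_pdivrMr; last by lra.
have -> : (1 + x + 2 / 3 * x ^+ 2) * (1 - x / 3) =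
  1 + 2 / 3 * x + x ^+ 2 / 6 + x ^+ 2 * (1 / 6 - 2 / 9 * x) by field.
by rewrite lerDl mulr_ge0 ?sqr_ge0 //; lra.
Qed.

(** Hoeffding's lemma for a Bernoulli variable: the second derivative of the logarithm of the moment
    generating function is the variance of a tilted Bernoulli variable, hence at most 1/4. *)
Lemma bernoulli_mgf_le x p : 0 <= x -> 0 <= p <= 1 ->
  1 + p * (expR x - 1) <= expR (p * x + x ^+ 2 / 8).
Proof.
move=> x0 /andP[p0 p1].
pose D (y : R) := 1 + p * (expR y - 1).
have D0 (y : R) : 0 <= y -> 0 < D y.
  move=> y0; rewrite /D; have : 1 <= expR y by rewrite -expR0 ler_expR.
  nra.
have dln (y : R) : 0 <= y ->
    is_derive y (1 : R) (fun y => ln (D y)) (p * expR y / D y).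
  move=> y0.
  have dD : is_derive y (1 : R) D (p * expR y).
    by apply: is_derive_eq; rewrite /GRing.scale /=; field.
  have := is_derive1_comp (is_derive1_ln (D0 _ y0)) dD.
  by rewrite /GRing.scale /= mulrC.
suff : 0 <= p * x + x ^+ 2 / 8 - ln (D x).
  by rewrite subr_ge0 -ler_expR lnK ?posrE ?D0.
refine (@ge0_of_derive (fun y : R => p * y + y ^+ 2 / 8 - ln (D y))
  (fun y : R => p + y / 4 - p * expR y / D y) _ _ _ x x0).
- move=> y y0; have dl := dln _ y0.
  apply: is_derive_eq; rewrite /GRing.scale /=; field.
  by rewrite gt_eqF ?D0.
- refine (@ge0_of_derive _
    (fun y : R => 1 / 4 - p * (1 - p) * expR y / D y ^+ 2) _ _ _).
  + move=> y y0; have Dy := D0 _ y0; have Dn : D y != 0 by rewrite gt_eqF.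
    have dD : is_derive y (1 : R) D (p * expR y).
      by apply: is_derive_eq; rewrite /GRing.scale /=; field.
    have dV : is_derive y (1 : R) (fun y => (D y)^-1)
        (- (p * expR y / D y ^+ 2)).
      by apply: is_derive_eq; rewrite /GRing.scale /=; field.
    apply: is_derive_eq; rewrite /GRing.scale /=.
    have -> : p * (1 - p) * expR y = p * expR y * D y - (p * expR y) ^+ 2.
      by rewrite /D; ring.
    by rewrite -!exprVn; field.
  + move=> y y0; have Dy := D0 _ y0.
    rewrite subr_ge0 ler_pdivrMr ?exprn_gt0 //.
    (* This square equals D^2 - 4 p (1 - p) e^y. *)
    have := sqr_ge0 (1 - p - p * expR y); rewrite /D; nra.
  + by rewrite /D expR0 subrr !mulr0 addr0; field.
- by rewrite /D expR0 subrr !mulr0 addr0 ln1; field.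
Qed.

(** A rare event and its complement both get an error proportional to [delta]. For the complement
    the factor e^x is pulled out, which leaves the generating function of the rare event at -x. *)
Lemma poisson_mgf_le x p delta : 0 <= x <= 3 / 4 -> 0 <= p <= delta ->
  1 + p * (expR x - 1) <= expR (x * p + 2 / 3 * delta * x ^+ 2) /\
  1 + (1 - p) * (expR x - 1) <= expR (x * (1 - p) + 2 / 3 * delta * x ^+ 2).
Proof.
move=> x34 /andP[p0 pd]; have /andP[x0 _] := x34.
have px : p * x ^+ 2 <= delta * x ^+ 2 by rewrite ler_wpM2r ?sqr_ge0.
have px0 : 0 <= p * x ^+ 2 by rewrite mulr_ge0 ?sqr_ge0.
split.
  apply: (le_trans (expR_ge1Dx _)); rewrite ler_expR.
  have : p * (expR x - 1) <= p * (x + 2 / 3 * x ^+ 2).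
    by rewrite ler_wpM2l //; have := expR_le_quadratic x34; lra.
  lra.
have -> : 1 + (1 - p) * (expR x - 1) = expR x * (1 + p * (expR (- x) - 1)).
  transitivity (expR x + p * (expR x * expR (- x)) - p * expR x); last by ring.
  by rewrite expRxMexpNx_1; ring.
apply: (@le_trans _ _ (expR x * expR (p * (expR (- x) - 1)))).
  by rewrite ler_wpM2l ?expR_ge0 ?expR_ge1Dx.
rewrite -expRD ler_expR.
have : p * (expR (- x) - 1) <= p * (- x + x ^+ 2 / 2).
  by rewrite ler_wpM2l //; have := expRN_le_quadratic x0; lra.
lra.
Qed.

End exponential.

(** * Nets of boxes *)

Section cover.
Context {R : realType} {d : nat}.
Implicit Types (a x y : d.-tuple R) (q tau : R).

Definition volume a : R := \prod_(i < d) tnth a i.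

Definition below a b := forall i : 'I_d, tnth a i <= tnth b i.

Definition cube tau : set (d.-tuple R) :=
  [set a | forall i, 0 <= tnth a i <= tau].

Lemma volume_ge0 a tau : cube tau a -> 0 <= volume a.
Proof. by move=> ha; apply: prodr_ge0 => i _; case/andP: (ha i). Qed.

Lemma le_volume a b tau : cube tau a -> below a b -> volume a <= volume b.
Proof.
by move=> ha ab; apply: ler_prod => i _; rewrite ab; case/andP: (ha i) => ->.
Qed.

Lemma volume_le1 a : cube 1 a -> volume a <= 1.
Proof. by move=> ha; rewrite /volume prodr_ile1 // => i _; exact: ha.
Qed.

(** Take admissible exponents of maximal sum. If the sum has not reached [m], no single exponent can
    be raised, and this bounds every [a i] from below. *)
Lemma grid_rounding q (m : nat) (a : 'I_d -> R) : (forall i, a i <= 1) ->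
  exists n : 'I_d -> nat, [/\ (\sum_i n i <= m)%N, forall i, a i <= q ^+ n i &
    (\sum_i n i)%N = m \/ forall i, q ^+ (n i).+1 <= a i].
Proof.
move=> a1.
pose p k := `[< exists n : 'I_d -> nat, [/\ (\sum_i n i)%N = k, (k <= m)%N &
                 forall i, a i <= q ^+ n i] >].
have ex : exists k, p k.
  by exists 0%N; apply/asboolP; exists (fun=> 0%N); rewrite big1.
have ub k : p k -> (k <= m)%N by move/asboolP => [n []].
case: (ex_maxnP ex ub) => k /asboolP[n [nk km an]] kmax.
exists n; rewrite nk; split => //.
have [->|km'] := eqVneq k m; [by left|right => i].
rewrite leNgt; apply/negP => ai.
have : p k.+1.
  apply/asboolP; exists (fun j => (n j + (j == i))%N); split.
  - rewrite big_split /= nk (bigD1 i) //= eqxx big1 ?addn0 ?addn1 //.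
    by move=> j /negbTE ->.
  - by rewrite ltn_neqAle km' km.
  - move=> j; case: eqVneq => [->|_]; last by rewrite addn0.
    by rewrite addn1 ltW.
by move/kmax; rewrite ltnn.
Qed.

(* Truncation at [tau < 1] keeps the box in [anchored_boxes]. *)
Definition grid_point q tau (n : 'I_d -> nat) : d.-tuple R :=
  [tuple Num.min (q ^+ n i) tau | i < d].

Definition grid q tau (K : nat) : seq (d.-tuple R) :=
  [seq grid_point q tau (fun i => tnth t i : nat)
    | t : d.-tuple 'I_K.+1
      in [set t : d.-tuple 'I_K.+1 | (\sum_(i <- t) i <= K)%N]%SET].

Lemma size_grid q tau K : size (grid q tau K) = 'C(d + K, d).
Proof. by rewrite size_map -cardE card_partial_ord_partitions. Qed.

Lemma mem_grid q tau K n :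
  (\sum_i n i <= K)%N -> grid_point q tau n \in grid q tau K.
Proof.
move=> nK; have ni i : (n i < K.+1)%N.
  by rewrite ltnS (leq_trans _ nK)// (bigD1 i) //= leq_addr.
apply/mapP; exists [tuple inord (n i) | i < d].
  rewrite mem_enum inE big_tuple (eq_bigr n) // => i _.
  by rewrite tnth_mktuple inordK.
by apply: eq_from_tnth => i; rewrite !tnth_mktuple inordK.
Qed.

Lemma grid_cube q tau K a : 0 < q -> 0 <= tau -> a \in grid q tau K ->
  cube tau a.
Proof.
move=> q0 t0 /mapP[t _ ->] i.
by rewrite tnth_mktuple le_min t0 ge_min lexx orbT exprn_ge0 // ltW.
Qed.

(* A box of volume at most [delta] needs no lower neighbour: its deviation from
   below is at most [delta]. *)
Definition covers (G : seq (d.-tuple R)) (delta : R) (A : set (d.-tuple R)) :=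
  forall a, A a -> exists y,
    [/\ y \in G, below a y, volume y <= volume a + delta & volume a <= delta \/
      exists x, [/\ x \in G, below x a & volume a <= volume x + delta]].

(** The rounded exponents give the upper neighbour; raising each by one gives the lower neighbour,
    at the price of [d] more units in the grid. The two volumes differ at most by the factor q^(-d)
    = 1 + t, hence by at most vhi t. If rounding exhausts the budget [m], the upper volume is at
    most q^m, which forces the box to be negligible. *)
Lemma grid_covers q tau (t : R) (m : nat) (vlo vhi delta : R) :
  0 < q -> tau <= 1 -> 0 <= t -> (1 + t) * q ^+ d = 1 -> vhi * t <= delta ->
  q ^+ m < vlo \/ q ^+ m <= delta ->
  covers (grid q tau (m + d)) delta
    [set a | cube tau a /\ vlo <= volume a <= vhi].
Proof.
move=> q0 tau1 t0 tq vt qm a [ca /andP[va1 va2]].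
have a1 i : tnth a i <= 1 by rewrite (le_trans _ tau1); case/andP: (ca i).
have [n [nm an nm']] := grid_rounding q m a1.
have qn k : 0 <= q ^+ k by rewrite exprn_ge0 // ltW.
have cy : cube tau (grid_point q tau n).
  move=> i; rewrite tnth_mktuple le_min qn ge_min lexx orbT.
  by case/andP: (ca i) => a0 /(le_trans a0) ->.
have ay : below a (grid_point q tau n).
  by move=> i; rewrite tnth_mktuple le_min an; case/andP: (ca i).
have vy : volume (grid_point q tau n) <= q ^+ (\sum_i n i).
  rewrite (big_morph _ (exprD q) (expr0 q)); apply: ler_prod => i _.
  by case/andP: (cy i) => -> _; rewrite tnth_mktuple ge_min lexx.
have vay := le_volume ca ay.
have v0 := volume_ge0 ca.
have yG : grid_point q tau n \in grid q tau (m + d).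
  by apply: mem_grid; rewrite (leq_trans nm) // leq_addr.
have t_delta : volume a * t <= delta.
  by rewrite (le_trans _ vt) // ler_wpM2r.
case: nm' => [nm'|na].
  rewrite nm' in vy; have qd : q ^+ m <= delta by case: qm => //; lra.
  by exists (grid_point q tau n); split => //; [lra|left; lra].
pose lo := grid_point q tau (fun i => (n i).+1).
have loE i : tnth lo i = q ^+ (n i).+1.
  by rewrite tnth_mktuple min_l // (le_trans (na i)) //; case/andP: (ca i).
have la : below lo a by move=> i; rewrite loE.
have clo : cube tau lo.
  move=> i; rewrite loE qn (le_trans (na i)) //.
  by case/andP: (ca i).
have vlo_eq : volume lo = q ^+ (\sum_i n i) * q ^+ d.
  rewrite /volume (eq_bigr _ (fun i _ => loE i)).
  rewrite (big_morph _ (exprD q) (expr0 q)); under eq_bigr do rewrite exprS.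
  by rewrite big_split /= prodr_const card_ord mulrC.
have vyl : volume (grid_point q tau n) <= volume lo + volume lo * t.
  apply: (le_trans vy); rewrite vlo_eq.
  by rewrite -[leLHS]mulr1 -tq le_eqVlt; apply/orP; left; apply/eqP; ring.
have vla := le_volume clo la.
have vt' : volume lo * t <= volume a * t by rewrite ler_wpM2r.
exists (grid_point q tau n); split => //; first lra.
right; exists lo; split => //; last lra.
apply: mem_grid; under eq_bigr do rewrite -addn1.
by rewrite big_split /= sum1_card card_ord leq_add2r.
Qed.

End cover.

(** * Cardinality of the nets *)

Section cover_size.
Context {R : realType}.

(** The induction step is (1 + 1/(n+2))^(n+2) <= e. Starting at 2 gives d^d / d! <= 2 e^(d-2), which
    improves on e^d. *)
Lemma expn_le_fact n :
  (n.+2%:R : R) ^+ n.+2 <= 2 * expR 1 ^+ n * (n.+2)`!%:R.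
Proof.
elim: n => [|n IH].
  by rewrite expr0 (_ : 2`! = 2)%N //; lra.
rewrite [leLHS]exprS factS natrM [leRHS]mulrCA ler_wpM2l //.
have n0 : (0 : R) < n.+2%:R by rewrite ltr0n.
have -> : (n.+3%:R : R) = n.+2%:R * (1 + n.+2%:R^-1).
  by rewrite mulrDr mulr1 divff ?gt_eqF // -natr1.
rewrite exprMn [expR 1 ^+ n.+1]exprSr.
have -> : 2 * (expR 1 ^+ n * expR 1) * (n.+2)`!%:R =
  2 * expR 1 ^+ n * (n.+2)`!%:R * expR 1 :> R by ring.
apply: ler_pM => //; rewrite ?exprn_ge0 ?addr_ge0 ?invr_ge0 //.
rewrite -[in leRHS](@mulVf _ (n.+2%:R : R)) ?gt_eqF //.
by rewrite expRM_natr lerXn2r ?nnegrE ?addr_ge0 ?expR_ge0 ?invr_ge0 ?expR_ge1Dx.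
Qed.

Lemma ffact_leX n k : (n ^_ k <= n ^ k)%N.
Proof.
elim: k n => [|k IH] [|n] //; rewrite ffactSS expnS leq_mul2l /=.
apply: (leq_trans (IH _)); case: k {IH} => // k.
by rewrite leq_exp2r.
Qed.

(** The exponent vectors number C(d + K, d) <= (d + K)^d / d! <= (d A)^d / d!. *)
Lemma size_grid_le d (q tau : R) (K : nat) (A : R) : (2 <= d)%N ->
  K%:R <= d%:R * (A - 1) ->
  (size (grid (d := d) q tau K))%:R <= 2 * expR (- 2) * (expR 1 * A) ^+ d.
Proof.
move=> d2 KA; rewrite size_grid.
have fd : (0 : R) < d`!%:R by rewrite ltr0n fact_gt0.
rewrite -(ler_pM2r fd) -natrM bin_ffact.
apply: (@le_trans _ _ ((d + K)%:R ^+ d)).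
  by rewrite -natrX ler_nat ffact_leX.
have dK : (d + K)%:R <= d%:R * A by rewrite natrD; lra.
apply: (@le_trans _ _ (d%:R ^+ d * A ^+ d)).
  by rewrite -exprMn lerXn2r ?nnegrE // (le_trans _ dK).
have A0 : 0 <= A.
  by rewrite -(pmulr_rge0 (x := d%:R)) ?ltr0n 1?ltnW // (le_trans _ dK).
case: d d2 {KA fd} dK => [//|[//|n]] _ dK.
apply: (@le_trans _ _ (2 * expR 1 ^+ n * (n.+2)`!%:R * A ^+ n.+2)).
  by rewrite ler_wpM2r ?exprn_ge0 ?expn_le_fact.
rewrite exprMn le_eqVlt; apply/orP; left; apply/eqP.
have -> : expR 1 ^+ n.+2 = expR 1 ^+ n * expR 2 :> R.
  by rewrite -!expRM_natr !mul1r -expRD -natrD addn2.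
rewrite (_ : 2 * expR (-2) * (expR 1 ^+ n * expR 2 * A ^+ n.+2) * (n.+2)`!%:R =
  (expR 2 * expR (- 2)) * (2 * expR 1 ^+ n * (n.+2)`!%:R * A ^+ n.+2) :> R).
  by rewrite expRxMexpNx_1 mul1r.
by ring.
Qed.

(** This is 1 - y <= e^(-y) at y = ln (1 + t). *)
Lemma invf_ln_le (t : R) : 0 < t -> (ln (1 + t))^-1 <= 1 + t^-1.
Proof.
move=> t0; have t1 : 0 < 1 + t by lra.
have lnt : t / (1 + t) <= ln (1 + t).
  have := expR_ge1Dx (- ln (1 + t)); rewrite expRN lnK ?posrE //.
  have -> : t / (1 + t) = 1 - (1 + t)^-1 by field; rewrite gt_eqF.
  lra.
have -> : 1 + t^-1 = (t / (1 + t))^-1 by field; rewrite !gt_eqF.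
have h : 0 < t / (1 + t) by rewrite divr_gt0.
by rewrite lef_pV2 ?posrE // (lt_le_trans h).
Qed.

(** The step is fixed by q^(-d) = 1 + t, and [m] is chosen so that q^m < e^(-M), that is, m > d M /
    ln (1 + t). *)
Lemma layer_cover d (tau t M A vlo vhi delta : R) :
  (2 <= d)%N -> 0 <= tau <= 1 -> 0 < t -> 0 <= M -> vhi * t <= delta ->
  expR (- M) <= vlo \/ expR (- M) <= delta ->
  5 / 2 + M * (1 + t^-1) <= A ->
  exists G : seq (d.-tuple R), [/\ forall y, y \in G -> cube tau y,
    (size G)%:R <= 2 * expR (- 2) * (expR 1 * A) ^+ d &
    covers G delta [set a | cube tau a /\ vlo <= volume a <= vhi]].
Proof.
move=> d2 /andP[tau0 tau1] t0 M0 vt Mv MA.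
have d0 : (0 : R) < d%:R by rewrite ltr0n ltnW.
have d2' : (2 : R) <= d%:R by rewrite ler_nat.
pose h := ln (1 + t); have t1 : 0 < 1 + t by lra.
have h0 : 0 < h by rewrite ln_gt0 //; lra.
pose q := expR (- (h / d%:R)).
have Mh0 : 0 <= d%:R * M / h by rewrite divr_ge0 ?mulr_ge0 // ltW.
pose m := (Num.truncn (d%:R * M / h)).+1.
have /andP[m1 m2] := truncn_itv Mh0.
have qd : (1 + t) * q ^+ d = 1.
  rewrite /q -expRM_natr mulNr divfK ?gt_eqF // expRN lnK ?posrE //.
  by rewrite divff ?gt_eqF.
have qm : q ^+ m < expR (- M).
  rewrite /q -expRM_natr ltr_expR mulNr ltrN2 mulrAC ltr_pdivlMr //.
  by rewrite mulrC [ltRHS]mulrC -ltr_pdivrMr.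
exists (grid q tau (m + d)); split.
- by move=> y; apply: grid_cube => //; exact: expR_gt0.
(* Rounding up costs 1 <= d / 2. Together with the [d] extra units of the grid and the [d]
   subtracted in [size_grid_le] this accounts for 5/2. *)
- have mA : m%:R <= d%:R * (1 / 2 + M * (1 + t^-1)).
    rewrite /m -natr1.
    have : d%:R * M / h <= d%:R * (M * (1 + t^-1)).
      by rewrite -mulrA ler_wpM2l ?ler_wpM2l ?invf_ln_le // ltW.
    move/(le_trans m1) => m3; rewrite [leRHS]mulrDr addrC.
    by rewrite lerD // mul1r ler_pdivlMr // mul1r.
  apply: size_grid_le => //; rewrite natrD (le_trans (lerD mA (lexx _))) //.
  rewrite -[X in _ + X]mulr1 -mulrDr ler_pM2l //.
  by move: MA; set u := M * _ => MA; lra.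
- have q0 : 0 < q by exact: expR_gt0.
  refine (grid_covers q0 tau1 (ltW t0) qd vt _).
  case: Mv => Mv; [left; exact: lt_le_trans Mv|right].
  by rewrite ltW // (lt_le_trans qm).
Qed.

End cover_size.

(** * Tail bounds under negative dependence *)

Section negative_dependence_tail.
Context {R : realType} {disp : measure_display} {Omega : measurableType disp}.
Variables (P : probability Omega R) (N : nat).

Lemma integral_scaled_indic (A : set Omega) (k : R) : 0 <= k -> measurable A ->
  (\int[P]_w (k * \1_A w)%:E = k%:E * P A)%E.
Proof.
move=> k0 mA; under eq_integral do rewrite EFinM.
rewrite ge0_integralZl//.
- by rewrite integral_indic// setIT.
- by apply/measurable_EFinP; exact: measurable_indic.
Qed.

(** Markov's inequality for e^(x S). As x >= 0, the coefficients (e^x - 1)^|u| of the expansion are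
    nonnegative, so the bounds on joint probabilities can be inserted term by term and the sum
    folded back into a product. *)
Lemma chernoff_joint_bound (B : 'I_N -> set Omega) (p gamma x a : R) :
  (forall j, measurable (B j)) -> 0 <= x ->
  (forall u : {set 'I_N},
    (P (\bigcap_(j in [set` u]) B j) <= (gamma * p ^+ #|u|)%:E)%E) ->
  (P [set w | (a <= \sum_j \1_(B j) w)%R] <=
    (gamma * expR (- (x * a)) * (1 + p * (expR x - 1)) ^+ N)%:E)%E.
Proof.
move=> mB x0 hB.
pose S w : R := \sum_j \1_(B j) w.
pose C (u : {set 'I_N}) := \bigcap_(j in [set` u]) B j.
have mC u : measurable (C u) by apply: fin_bigcap_measurable.
have mS : measurable_fun setT S.
  by apply: measurable_sum => j; exact: measurable_indic.
have mE : measurable [set w | a <= S w].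
  rewrite [X in measurable X](_ : _ = S @^-1` `[a, +oo[%classic).
    by rewrite -[X in measurable X]setTI; exact: mS.
  by apply/seteqP; split => w /=; rewrite in_itv /= andbT.
have x1 : 0 <= expR x - 1 by rewrite subr_ge0 -expR0 ler_expR.
have expS w : expR (x * S w) =
    \sum_(u : {set 'I_N}) (expR x - 1) ^+ #|u| * \1_(C u) w.
  rewrite mulr_sumr expR_sum.
  under eq_bigr => j _.
    have -> : expR (x * \1_(B j) w) = (expR x - 1) * \1_(B j) w + 1.
      rewrite indicE; case: (w \in B j); rewrite ?mulr1 ?subrK //.
      by rewrite !mulr0 expR0 add0r.
    over.
  rewrite bigA_distr; apply: eq_bigr => u _.
  rewrite -big_mkcond /= big_split /= prodr_const; congr (_ * _).
  have [wC|wC] := boolP (w \in C u).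
    rewrite indicE wC big1 // => j ju; rewrite indicE mem_set //.
    by move: wC; rewrite inE; exact.
  rewrite indicE (negbTE wC) /=.
  have [j ju wj] : exists2 j, j \in u & w \notin B j.
    move: wC; rewrite notin_setE => wC; apply: contrapT => h; apply: wC => j ju.
    by apply: contrapT => wj; apply: h; exists j => //; rewrite notin_setE.
  by rewrite (bigD1 j) //= indicE (negbTE wj) mul0r.
have : (\int[P]_w (expR (x * a) * \1_[set w | a <= S w] w)%:E <=
        \int[P]_w
          (\sum_(u : {set 'I_N}) ((expR x - 1) ^+ #|u| * \1_(C u) w)%:E))%E.
  apply: ge0_le_integral => //.
  - by apply/measurable_EFinP/measurable_funM => //; exact: measurable_indic.
  - apply: emeasurable_sum => u.
    by apply/measurable_EFinP/measurable_funM => //; exact: measurable_indic.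
  - move=> w _; rewrite sumEFin lee_fin -expS indicE.
    case: (boolP (w \in _)); last by rewrite mulr0 expR_ge0.
    by rewrite inE /= mulr1 => aS; rewrite ler_expR ler_wpM2l.
rewrite integral_scaled_indic ?expR_ge0 //.
rewrite ge0_integral_sum //=; last 2 first.
- by move=> u; apply/measurable_EFinP/measurable_funM => //;
    exact: measurable_indic.
- by move=> u w _; rewrite lee_fin mulr_ge0 ?exprn_ge0.
under eq_bigr do rewrite integral_scaled_indic ?exprn_ge0 //.
move=> h; have : (\sum_(u : {set 'I_N}) ((expR x - 1) ^+ #|u|)%:E * P (C u) <=
    (gamma * (1 + p * (expR x - 1)) ^+ N)%:E)%E.
  apply: (@le_trans _ _ (\sum_(u : {set 'I_N})
      ((expR x - 1) ^+ #|u| * (gamma * p ^+ #|u|))%:E)%E).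
    apply: lee_sum => u _; rewrite EFinM lee_wpmul2l ?lee_fin ?exprn_ge0 //.
    exact: hB.
  rewrite sumEFin lee_fin.
  have -> : (1 + p * (expR x - 1)) ^+ N = \prod_(j < N) (p * (expR x - 1) + 1).
    by rewrite prodr_const card_ord addrC.
  rewrite bigA_distr mulr_sumr le_eqVlt; apply/orP; left; apply/eqP.
  apply: eq_bigr => u _; rewrite -big_mkcond /= prodr_const exprMn; ring.
move=> /(le_trans h); rewrite -lee_pdivlMl ?expR_gt0 // => /le_trans; apply.
by rewrite -EFinM lee_fin expRN [leLHS]mulrCA mulrA.
Qed.

End negative_dependence_tail.

Section two_sided_tail.
Context {R : realType} {disp : measure_display} {Omega : measurableType disp}.
Variables (P : probability Omega R) (N d : nat).
Variable X : {RV P >-> N.-tuple (d.-tuple R)}.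

Definition frequency (p : N.-tuple (d.-tuple R)) (Q : set (d.-tuple R)) : R :=
  #|[pred j : 'I_N | tnth p j \in Q]|%:R / N%:R.

Lemma sum_indic_card (b : 'I_N -> bool) :
  \sum_j ((b j)%:R : R) = #|[pred j | b j]|%:R.
Proof.
rewrite -sum1_card natr_sum [RHS]big_mkcond; apply: eq_bigr => j _.
by rewrite inE; case: (b j).
Qed.

Lemma measurable_hit (Q : set (d.-tuple R)) j b : measurable Q ->
  measurable [set w | (tnth (X w) j \in Q) = b].
Proof.
move=> mQ; have mh : measurable [set w | (tnth (X w) j \in Q) = true].
  rewrite [X in measurable X](_ : _ = X @^-1` ((@tnth N _)^~ j @^-1` Q)).
    rewrite -[X in measurable X]setTI; apply: measurable_funPT => //.
    by rewrite -[X in measurable X]setTI; exact: measurable_tnth.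
  by apply/seteqP; split=> w /=; [move/set_mem|move/mem_set].
case: b => //; rewrite [X in measurable X](_ : _ =
    ~` [set w | (tnth (X w) j \in Q) = true]).
  exact: measurableC.
by apply/seteqP; split=> w /=; case: (_ \in _).
Qed.

Lemma measurable_frequency (Q : set (d.-tuple R)) : measurable Q ->
  measurable_fun setT (fun w => frequency (X w) Q).
Proof.
move=> mQ; apply: measurable_funM => //.
under eq_fun do rewrite -sum_indic_card.
apply: measurable_sum => j.
rewrite (_ : (fun w => _) = \1_[set w | (tnth (X w) j \in Q) = true]).
  exact/measurable_indic/measurable_hit.
apply/funext => w; rewrite indicE; congr (_%:R); congr nat_of_bool.
by apply/idP/idP => [/mem_set//|/set_mem].
Qed.

(** A lower deviation of the frequency is an upper deviation for the complementary indicators, to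
    which the [false] half of negative dependence applies. The error [b] stays free so that both
    moment bounds above fit. *)
Lemma neg_dep_tail (Q : set (d.-tuple R)) (p gamma x b t : R) :
  (0 < N)%N -> measurable Q -> 0 <= x -> 0 <= gamma ->
  (forall j, P [set w | Q (tnth (X w) j)] = p%:E) ->
  negatively_dependent P gamma (fun j w => tnth (X w) j \in Q) ->
  1 + p * (expR x - 1) <= expR (x * p + b) ->
  1 + (1 - p) * (expR x - 1) <= expR (x * (1 - p) + b) ->
  (P [set w | (t <= `|frequency (X w) Q - p|)%R] <=
    (2 * gamma * expR (- (N%:R * (x * t - b))))%:E)%E.
Proof.
move=> N0 mQ x0 g0 hp hn mgf1 mgf0.
pose B c j := [set w | (tnth (X w) j \in Q) = c].
have mB c j : measurable (B c j) by exact: measurable_hit.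
have memB c j w : (w \in B c j) = ((tnth (X w) j \in Q) == c).
  by apply/idP/eqP => [/set_mem|/mem_set].
have P1 j : P (B true j) = p%:E.
  rewrite -(hp j); congr (P _).
  by apply/seteqP; split=> w /=; [move/set_mem|move/mem_set].
have P0 j : P (B false j) = (1 - p)%:E.
  rewrite EFinB -(P1 j) -probability_setC //; congr (P _).
  by apply/seteqP; split=> w; rewrite /B /=; case: (_ \in _).
have tail c q : (forall j, P (B c j) = q%:E) ->
    1 + q * (expR x - 1) <= expR (x * q + b) ->
    (forall u : {set 'I_N}, (P (\bigcap_(j in [set` u]) B c j) <=
       gamma%:E * \prod_(j in u) P (B c j))%E) ->
    (P [set w | (N%:R * (q + t) <= \sum_j \1_(B c j) w)%R] <=
      (gamma * expR (- (N%:R * (x * t - b))))%:E)%E.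
  move=> hq mgf hu.
  have q0 : 0 <= q.
    by rewrite -lee_fin -(hq (Ordinal N0)).
  have hu' (u : {set 'I_N}) :
      (P (\bigcap_(j in [set` u]) B c j) <= (gamma * q ^+ #|u|)%:E)%E.
    rewrite (le_trans (hu u)) // (eq_bigr _ (fun j _ => hq j)).
    by rewrite prodEFin EFinM prodr_const.
  apply: (le_trans (chernoff_joint_bound (N%:R * (q + t)) (mB c) x0 hu')).
  rewrite lee_fin -mulrA ler_wpM2l //.
  have x1 : 1 <= expR x by rewrite -expR0 ler_expR.
  apply: (@le_trans _ _
      (expR (- (x * (N%:R * (q + t)))) * expR (x * q + b) ^+ N)).
    rewrite ler_wpM2l ?expR_ge0 // lerXn2r ?nnegrE ?expR_ge0 //.
    by rewrite addr_ge0 // mulr_ge0 // subr_ge0.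
  by rewrite -expRM_natl -expRD ler_expR; lra.
have mE c q : measurable [set w | q <= \sum_j (\1_(B c j) w : R)].
  have mS : measurable_fun setT (fun w => \sum_j (\1_(B c j) w : R)).
    by apply: measurable_sum => j; exact: measurable_indic.
  rewrite [X in measurable X](_ : _ =
      (fun w => \sum_j (\1_(B c j) w : R)) @^-1` `[q, +oo[%classic).
    by rewrite -[X in measurable X]setTI; exact: mS.
  by apply/seteqP; split => w /=; rewrite in_itv /= andbT.
have freqE w : \sum_j (\1_(B true j) w : R) = N%:R * frequency (X w) Q.
  rewrite /frequency mulrC divfK ?pnatr_eq0 ?lt0n_neq0 // -sum_indic_card.
  by apply: eq_bigr => j _; rewrite indicE memB eqb_id.
have freqE' w : \sum_j (\1_(B false j) w : R) = N%:R * (1 - frequency (X w) Q).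
  rewrite mulrBr -freqE mulr1 -[X in X%:R - _](card_ord N) -sum1_card.
  rewrite natr_sum -sumrB.
  apply: eq_bigr => j _; rewrite !indicE !memB.
  by case: (_ \in _); rewrite /= ?subrr ?subr0.
have sub : [set w | t <= `|frequency (X w) Q - p|] `<=`
   [set w | N%:R * (p + t) <= \sum_j (\1_(B true j) w : R)] `|`
   [set w | N%:R * (1 - p + t) <= \sum_j (\1_(B false j) w : R)].
  move=> w /=; rewrite freqE freqE' !ler_pM2l ?ltr0n // ler_normr.
  by case/orP => h; [left|right]; lra.
apply: (le_trans (le_measure _ _ _ sub)); rewrite ?inE.
- rewrite [X in measurable X](_ : _ =
      (fun w => `|frequency (X w) Q - p|) @^-1` `[t, +oo[%classic).
    rewrite -[X in measurable X]setTI.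
    apply: measurableT_comp => //; apply: measurable_funB => //.
    exact: measurable_frequency.
  by apply/seteqP; split => w /=; rewrite in_itv /= andbT.
- by apply: measurableU; exact: mE.
apply: (le_trans (measureU2 _ (mE _ _) (mE _ _))).
rewrite -[_ * expR _]mulrA [2 * _](mulr_natl _ 2) mulr2n.
rewrite EFinD; apply: leeD; apply: tail => // u.
- exact: (hn u).1.
- exact: (hn u).2.
Qed.
End two_sided_tail.

(** * Lebesgue measure and empirical frequency of anchored boxes *)

Section boxes.
Context {R : realType} {d : nat}.
Implicit Types (a x y z : d.-tuple R).

Lemma measurable_anchored_box a : measurable (anchored_box a).
Proof.
rewrite (_ : anchored_box a = \bigcap_(i in [set: 'I_d])
    ((@tnth d R)^~ i @^-1` `[0, tnth a i[%classic)); last first.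
  apply/seteqP; split=> x /= h i; first by move=> _; rewrite /= in_itv /= h.
  by have := h i I; rewrite /= in_itv.
apply: fin_bigcap_measurable => // i _; rewrite -[X in measurable X]setTI.
exact: (@measurable_tnth _ _ _ i measurableT _ (measurable_itv _)).
Qed.

Lemma lebesgue_anchored_box a tau : cube tau a ->
  lebesgue_tuple d (anchored_box a) = (volume a)%:E.
Proof.
move=> ca; have := @lebesgue_tuple_itv R d [tuple 0 | _ < d] a.
have -> : [set x | forall i, tnth [tuple 0 | _ < d] i <= tnth x i < tnth a i] =
    anchored_box a.
  by apply/seteqP; split=> x /= h i; have := h i; rewrite tnth_mktuple.
move=> ->; last by move=> i; rewrite tnth_mktuple; case/andP: (ca i).
by congr EFin; apply: eq_bigr => i _; rewrite tnth_mktuple subr0.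
Qed.

Lemma subset_anchored_box z y : below z y -> anchored_box z `<=` anchored_box y.
Proof.
by move=> zy x h i; case/andP: (h i) => -> /lt_le_trans; exact.
Qed.

Lemma lebesgue_box_diff z y tau : cube tau z -> cube tau y -> below z y ->
  lebesgue_tuple d (anchored_box y `\` anchored_box z) =
  (volume y - volume z)%:E.
Proof.
move=> cz cy zy.
have my := measurable_anchored_box y; have mz := measurable_anchored_box z.
have fy : (lebesgue_tuple d (anchored_box y) < +oo)%E.
  by rewrite (lebesgue_anchored_box cy) ltry.
have -> := measureD (mu := lebesgue_tuple d) my mz fy.
rewrite setIC (setIidl (subset_anchored_box zy)) EFinB.
congr (_ - _)%E; first exact: lebesgue_anchored_box cy.
exact: lebesgue_anchored_box cz.
Qed.

Lemma anchored_box0 : (0 < d)%N -> anchored_box [tuple (0 : R) | _ < d] = set0.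
Proof.
move=> d0; apply/seteqP; split=> // x /(_ (Ordinal d0)).
by rewrite tnth_mktuple => /andP[/le_lt_trans h /h]; rewrite ltxx.
Qed.

Lemma unit_cube_cube y : unit_cube y -> cube 1 y.
Proof. by move=> h i; case/andP: (h i) => -> /ltW ->. Qed.

Lemma cube_unit_cube tau y : tau < 1 -> cube tau y -> unit_cube y.
Proof. by move=> t1 h i; case/andP: (h i) => -> /le_lt_trans; exact. Qed.

Lemma frequency_le N (p : N.-tuple (d.-tuple R)) z y : below z y ->
  frequency p (anchored_box z) <= frequency p (anchored_box y).
Proof.
move=> zy; rewrite /frequency ler_wpM2r ?invr_ge0 // ler_nat subset_leq_card //.
by apply/fintype.subsetP => j; rewrite !inE => /(subset_anchored_box zy).
Qed.

Lemma frequency_diff N (p : N.-tuple (d.-tuple R)) z y : below z y ->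
  frequency p (anchored_box y `\` anchored_box z) =
  frequency p (anchored_box y) - frequency p (anchored_box z).
Proof.
move=> zy; rewrite /frequency -mulrBl -!sum_indic_card -sumrB; congr (_ / _).
apply: eq_bigr => j _; rewrite in_setD.
have [zj|] := boolP (tnth p j \in anchored_box z); last by rewrite andbT subr0.
have -> : tnth p j \in anchored_box y.
  by rewrite mem_set //; apply/(subset_anchored_box zy)/set_mem.
by rewrite subrr.
Qed.

Lemma frequency_box0 N (p : N.-tuple (d.-tuple R)) : (0 < d)%N ->
  frequency p (anchored_box [tuple (0 : R) | _ < d]) = 0.
Proof.
move=> d0; rewrite anchored_box0 // /frequency eq_card0 ?mul0r // => j.
by rewrite !inE; apply/negP => /set_mem.
Qed.

Lemma volume0 : (0 < d)%N -> volume [tuple (0 : R) | _ < d] = 0.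
Proof.
by move=> d0; rewrite /volume (bigD1 (Ordinal d0)) //= tnth_mktuple mul0r.
Qed.

End boxes.

(** * Tail bounds for boxes and differences of boxes *)

Section box_tails.
Context {R : realType} {disp : measure_display} {Omega : measurableType disp}.
Variables (P : probability Omega R) (N d : nat) (gamma : R).
Variable X : {RV P >-> N.-tuple (d.-tuple R)}.
Hypotheses (N0 : (0 < N)%N) (d0 : (0 < d)%N) (gamma0 : 0 <= gamma).
Hypotheses (hX : sampling_scheme X) (hn : D0_negatively_dependent X gamma).

Definition discrepancy (w : Omega) (a : d.-tuple R) : R :=
  frequency (X w) (anchored_box a) - volume a.

Lemma box_diff_tail (z y : d.-tuple R) (x b t : R) :
  unit_cube z -> unit_cube y -> below z y ->
  let p := volume y - volume z in 0 <= x ->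
  1 + p * (expR x - 1) <= expR (x * p + b) ->
  1 + (1 - p) * (expR x - 1) <= expR (x * (1 - p) + b) ->
  (P [set w | (t <= `|discrepancy w y - discrepancy w z|)%R] <=
    (2 * gamma * expR (- (N%:R * (x * t - b))))%:E)%E.
Proof.
move=> uz uy zy p x0 mgf1 mgf0.
pose Q := anchored_box y `\` anchored_box z.
have mQ : measurable Q by apply: measurableD; exact: measurable_anchored_box.
have cy := unit_cube_cube uy; have cz := unit_cube_cube uz.
have hp j : P [set w | Q (tnth (X w) j)] = p%:E.
  case: hX => _ hu _; rewrite hu // (setIidl _).
    exact: lebesgue_box_diff cz cy zy.
  move=> u [yu _] i; case/andP: (yu i) => -> /lt_trans; apply.
  by case/andP: (uy i).
have hQ : anchored_box_diffs Q.
  exists (anchored_box y); first by exists y.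
  by exists (anchored_box z) => //; exists z.
have := neg_dep_tail t N0 mQ x0 gamma0 hp (hn hQ) mgf1 mgf0.
congr (P _ <= _)%E; apply/funext => w /=; congr (_ <= `|_| : Prop).
by rewrite frequency_diff // /discrepancy /p; ring.
Qed.

(** A box is its own difference with the empty box of corner 0, so [box_diff_tail] applies. The
    value x = 4 t maximises x t - x^2/8. *)
Lemma box_hoeffding (y : d.-tuple R) (t : R) : unit_cube y -> 0 <= t ->
  (P [set w | (t <= `|discrepancy w y|)%R] <=
    (2 * gamma * expR (- (2 * N%:R * t ^+ 2)))%:E)%E.
Proof.
move=> uy t0; pose z : d.-tuple R := [tuple 0 | _ < d].
have uz : unit_cube z by move=> i; rewrite tnth_mktuple lexx ltr01.
have zy : below z y by move=> i; rewrite tnth_mktuple; case/andP: (uy i).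
have dz w : discrepancy w z = 0.
  by rewrite /discrepancy frequency_box0 // volume0 // subrr.
have x0 : 0 <= 4 * t by rewrite mulr_ge0.
have p1 : 0 <= volume y - volume z <= 1.
  rewrite volume0 // subr0 (volume_ge0 (unit_cube_cube uy)).
  exact/volume_le1/unit_cube_cube.
have p1' : 0 <= 1 - (volume y - volume z) <= 1 by lra.
have := bernoulli_mgf_le x0 p1; have := bernoulli_mgf_le x0 p1'.
rewrite ![_ * (4 * t)]mulrC => mgf0 mgf1.
have := box_diff_tail t uz uy zy x0 mgf1 mgf0.
have -> : 4 * t * t - (4 * t) ^+ 2 / 8 = 2 * t ^+ 2 by field.
rewrite mulrA [N%:R * 2]mulrC.
by under eq_set do rewrite dz subr0.
Qed.

(** The value x = 3 t / (4 delta) maximises x t - 2/3 delta x^2, with maximum 3/8 t^2 / delta; t <=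
    delta keeps x <= 3/4. *)
Lemma box_bernstein (z y : d.-tuple R) (t delta : R) :
  unit_cube z -> unit_cube y -> below z y -> volume y - volume z <= delta ->
  0 < delta -> 0 <= t <= delta ->
  (P [set w | (t <= `|discrepancy w y - discrepancy w z|)%R] <=
    (2 * gamma * expR (- (3 / 8 * N%:R * t ^+ 2 / delta)))%:E)%E.
Proof.
move=> uz uy zy pd delta0 /andP[t0 td].
have x34 : 0 <= 3 / 4 * (t / delta) <= 3 / 4.
  rewrite mulr_ge0 ?divr_ge0 ?(ltW delta0) //=.
  by rewrite ler_piMr // ler_pdivrMr // mul1r.
have p0 : 0 <= volume y - volume z <= delta.
  by rewrite pd subr_ge0 (le_volume (unit_cube_cube uz)).
have [mgf1 mgf0] := poisson_mgf_le x34 p0.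
have /andP[x0 _] := x34.
have := box_diff_tail t uz uy zy x0 mgf1 mgf0.
congr (_ <= _)%E; congr (_ * expR (- _))%:E; field.
by rewrite gt_eqF.
Qed.

Lemma measurable_discrepancy y : measurable_fun setT (discrepancy^~ y).
Proof.
apply: measurable_funB => //.
by apply: measurable_frequency; exact: measurable_anchored_box.
Qed.

End box_tails.

(** * Sizes of the nets *)

Section numerics.
Context {R : realType}.

Lemma expR_double_ge (a b x : R) :
  0 <= a -> b <= a ^+ 2 -> a <= expR x -> b <= expR (x * 2).
Proof.
by move=> a0 ba ax; rewrite expRM_natr (le_trans ba) // lerXn2r ?nnegrE.
Qed.

(** 461/200 is slightly above ln 10. The cubic bound is taken at one eighth of it and squared three
    times. *)
Lemma expR_ge10 : 10 <= expR (461 / 200 : R).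
Proof.
have y0 : (0 : R) <= 461 / 1600 by lra.
have h1 : (1667 / 1250 : R) <= expR (461 / 1600).
  by apply: le_trans (expR_ge_cubic y0); lra.
have h2 : (2223 / 1250 : R) <= expR (461 / 1600 * 2).
  by apply: expR_double_ge h1; lra.
have h3 : (253 / 80 : R) <= expR (461 / 1600 * 2 * 2).
  by apply: expR_double_ge h2; lra.
have -> : (461 / 200 : R) = 461 / 1600 * 2 * 2 * 2 by field.
by apply: expR_double_ge h3; lra.
Qed.

Lemma expR_ge10X (n : nat) : 10 ^+ n <= expR (461 / 200 * n%:R : R).
Proof.
by rewrite expRM_natr lerXn2r ?nnegrE ?expR_ge0 // expR_ge10.
Qed.

(** 23/25 is slightly above ln (5/2); it is the depth [M] of the top layer, of volumes at least
    2/5. *)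
Lemma expRN23_ge : expR (- (23 / 25)) <= (2 / 5 : R).
Proof.
have y0 : (0 : R) <= 23 / 50 by lra.
have h1 : (791 / 500 : R) <= expR (23 / 50).
  by apply: le_trans (expR_ge_cubic y0); lra.
have h2 : (5 / 2 : R) <= expR (23 / 25).
  have -> : (23 / 25 : R) = 23 / 50 * 2 by field.
  by apply: expR_double_ge h1; lra.
rewrite expRN -[leRHS]invrK lef_pV2 ?posrE ?expR_gt0 ?invr_gt0 //.
by apply: le_trans h2; lra.
Qed.

Lemma expRN2_le : expR (- 2) <= (3 / 19 : R).
Proof.
have h2 : (19 / 3 : R) <= expR 2.
  by apply: le_trans (expR_ge_cubic _); lra.
rewrite expRN -[leRHS]invrK lef_pV2 ?posrE ?expR_gt0 ?invr_gt0 //.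
by apply: le_trans h2; lra.
Qed.


Definition level (k : nat) : R := (1 / 10 ^+ 4) ^+ k.+1.

Lemma level_gt0 k : 0 < level k.
Proof. by rewrite exprn_gt0 // divr_gt0 // exprn_gt0. Qed.

Lemma levelE k : level k = (10 ^+ (4 * k.+1))^-1.
Proof. by rewrite /level div1r exprVn -exprM. Qed.

Lemma expRN_le_level k : expR (- (461 / 50 * k.+1%:R)) <= level k.
Proof.
rewrite levelE expRN lef_pV2 ?posrE ?expR_gt0 ?exprn_gt0 //.
apply: le_trans (expR_ge10X _) _; rewrite ler_expR natrM.
by rewrite mulrA (_ : 461 / 200 * 4 = 461 / 50 :> R) //; field.
Qed.

(** The layers are [2/5, 1], [1/10, 2/5] and [0, 1/10], with steps 10^(-4), 1/4000 and 1/1000 making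
    vhi t = 10^(-4) each time. The depths .92, 2.305 and 9.22 are such that 5/2 + M (1 + 1/t) is
    just below 9250 in all three. *)
Lemma level0_cover d (tau : R) : (2 <= d)%N -> 0 <= tau < 1 ->
  exists G : seq (d.-tuple R), [/\ forall y, y \in G -> cube tau y,
    (size G)%:R <= 6 * expR (- 2) * (expR 1 * (37 / 4 * 10 ^+ 3)) ^+ d :> R &
    covers G (level 0) (cube tau)].
Proof.
move=> d2 /andP[t0 t1]; have t01 : 0 <= tau <= 1 by rewrite t0 ltW.
have lE : (level 0 : R) = 1 / 10 ^+ 4 by rewrite /level expr1.
have e10 : expR (- (461 / 200)) <= (1 / 10 : R).
  by rewrite div1r expRN lef_pV2 ?posrE ?expR_gt0 // expR_ge10.
have e50 : expR (- (461 / 50)) <= level 0 :> R.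
  by have := expRN_le_level 0; rewrite mulr1.
have i10 (m : nat) (u : R) : 0 < u -> 0 < (u * 10 ^+ m)^-1.
  by move=> u0; rewrite invr_gt0 mulr_gt0 // exprn_gt0.
have v1 : 1 * (1 * 10 ^+ 4)^-1 <= level 0 :> R by rewrite lE mul1r; lra.
have v2 : 2 / 5 * (4 * 10 ^+ 3)^-1 <= level 0 :> R by rewrite lE; lra.
have v3 : 1 / 10 * (1 * 10 ^+ 3)^-1 <= level 0 :> R by rewrite lE mul1r; lra.
have [||G1 [c1 s1 g1]] := @layer_cover R d tau _ (23 / 25) (37 / 4 * 10 ^+ 3)
  (2 / 5) 1 (level 0) d2 t01 (i10 _ _ ltr01) _ v1 (or_introl expRN23_ge) _.
- lra.
- by rewrite invrK; lra.
have [|||G2 [c2 s2 g2]] := @layer_cover R d tau _ (461 / 200) (37 / 4 * 10 ^+ 3)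
  (1 / 10) (2 / 5) (level 0) d2 t01 (i10 _ _ _) _ v2 (or_introl e10) _.
- by [].
- lra.
- by rewrite invrK; lra.
have [||G3 [c3 s3 g3]] := @layer_cover R d tau _ (461 / 50) (37 / 4 * 10 ^+ 3)
  0 (1 / 10) (level 0) d2 t01 (i10 _ _ ltr01) _ v3 (or_intror e50) _.
- lra.
- by rewrite invrK; lra.
exists (G1 ++ G2 ++ G3); split.
- by move=> y; rewrite !mem_cat => /or3P[/c1|/c2|/c3].
- rewrite !size_cat !natrD; move: s1 s2 s3; set u := _ ^+ d; lra.
- have sub (G : seq (d.-tuple R)) a : covers G (level 0) a ->
      {subset G <= G1 ++ G2 ++ G3} -> covers (G1 ++ G2 ++ G3) (level 0) a.
    move=> cov sG x /cov[y [yG xy vy H]].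
    exists y; split => //; first exact: sG.
    case: H => [|[z [zG zx vz]]]; [by left|right].
    by exists z; split => //; exact: sG.
  move=> a ca; have v0 := volume_ge0 ca.
  have [h|h] := lerP (2 / 5) (volume a).
    apply: (sub _ _ g1) => [y|]; first by rewrite mem_cat => ->.
    split => //; rewrite h volume_le1 // => i.
    by case/andP: (ca i) => -> /le_trans -> //; exact: ltW.
  have [h'|h'] := lerP (1 / 10) (volume a).
    apply: (sub _ _ g2) => [y|]; first by rewrite !mem_cat => ->; rewrite orbT.
    by split => //; rewrite h' ltW.
  apply: (sub _ _ g3) => [y|]; first by rewrite !mem_cat => ->; rewrite !orbT.
  by split => //; rewrite v0 ltW.
Qed.

(** The constant [A] of [layer_cover] for a single layer holding all volumes in [0, 1], with t =
    [level k]. *)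
Definition level_base (k : nat) : R :=
  5 / 2 + 461 / 50 * k.+1%:R * (1 + 10 ^+ (4 * k.+1)).

Lemma level_cover d k (tau : R) : (2 <= d)%N -> 0 <= tau < 1 ->
  exists G : seq (d.-tuple R), [/\ forall y, y \in G -> cube tau y,
    (size G)%:R <= 2 * expR (- 2) * (expR 1 * level_base k) ^+ d :> R &
    covers G (level k) (cube tau)].
Proof.
move=> d2 /andP[t0 t1]; have t01 : 0 <= tau <= 1 by rewrite t0 ltW.
have M0 : 0 <= 461 / 50 * k.+1%:R :> R by apply: mulr_ge0; [lra|exact: ler0n].
have [||G [cG sG gG]] := @layer_cover R d tau (level k) (461 / 50 * k.+1%:R)
  (level_base k) 0 1 (level k) d2 t01 (level_gt0 k) M0 _
  (or_intror (expRN_le_level k)) _.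
- by rewrite mul1r.
- by rewrite levelE invrK.
exists G; split => // a ca; apply: gG; split => //.
rewrite (volume_ge0 ca) volume_le1 // => i.
by case/andP: (ca i) => -> /le_trans -> //; exact: ltW.
Qed.

Definition kappa : R := 1 + 6768 / 10 ^+ 4 + 1 / 10 ^+ 5.
Definition offset : R := 10 + 4529 / 10 ^+ 4 + 2 / 10 ^+ 5.

Lemma sqr_threshold (c : R) :
  2 + 4968 / 10 ^+ 4 < c -> 6234 / 10 ^+ 3 <= c ^+ 2.
Proof.
move=> hc; apply: (@le_trans _ _ ((2 + 4968 / 10 ^+ 4) ^+ 2)); first lra.
by rewrite lerXn2r ?nnegrE; lra.
Qed.

(** The decay [u] is split into the wanted rate [v] and a surplus that has to beat the net factor
    [A] per dimension. Of the gain theta^d only theta^2 is kept. *)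
Lemma power_exponent_le (d : nat) (A theta u v : R) : (2 <= d)%N -> 0 <= A ->
  A * expR (v - u) <= theta -> theta <= 1 ->
  A ^+ d * expR (- (u * d%:R)) <= expR (- (v * d%:R)) * theta ^+ 2.
Proof.
move=> d2 A0 Ath th1.
have t0 : 0 <= A * expR (v - u) by rewrite mulr_ge0 ?expR_ge0.
have -> : - (u * d%:R) = - (v * d%:R) + (v - u) * d%:R by ring.
rewrite expRD expRM_natr mulrCA -exprMn ler_wpM2l ?expR_ge0 //.
apply: (@le_trans _ _ (theta ^+ d)).
  by rewrite lerXn2r ?nnegrE // (le_trans t0).
by rewrite ler_wiXn2l // (le_trans t0).
Qed.

(** For c^2 >= 6.234 the exponent per dimension, including the factor e of the net size, is at most
    -9.72 = -(9.22 + .5). Hence theta = 9250 * 10^(-4) * 8/13 <= .57, and 12 e^(-2) theta^2 <= 3/4.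
    The 12 is 6 from the net times 2 from the two-sided tail. *)
Lemma level0_exponent (c : R) d : (2 <= d)%N -> 2 + 4968 / 10 ^+ 4 < c ->
  12 * expR (- 2) * (expR 1 * (37 / 4 * 10 ^+ 3)) ^+ d *
    expR (- (2 * (116 / 125) ^+ 2 * c ^+ 2 * d%:R)) <=
  expR (- ((kappa * c ^+ 2 - offset) * d%:R)) * (3 / 4).
Proof.
move=> d2 hc; have c2 := sqr_threshold hc.
have half : (13 / 8 : R) <= expR (1 / 2).
  by apply: le_trans (expR_ge_quadratic _); lra.
have l0 : expR (- (461 / 50)) <= (10 ^+ 4)^-1 :> R.
  by have := expRN_le_level 0; rewrite mulr1 levelE.
have lhalf : expR (- (1 / 2)) <= 8 / 13 :> R.
  by rewrite expRN -[leRHS]invrK lef_pV2 ?posrE ?expR_gt0 ?invr_gt0 //; lra.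
have ex : expR 1 *
    expR (kappa * c ^+ 2 - offset - 2 * (116 / 125) ^+ 2 * c ^+ 2) <=
    (10 ^+ 4)^-1 * (8 / 13) :> R.
  apply: (@le_trans _ _ (expR (- (461 / 50)) * expR (- (1 / 2)))).
    by rewrite -!expRD ler_expR /kappa /offset; lra.
  by apply: ler_pM; rewrite ?expR_ge0.
have th : expR 1 * (37 / 4 * 10 ^+ 3) *
    expR (kappa * c ^+ 2 - offset - 2 * (116 / 125) ^+ 2 * c ^+ 2) <=
    57 / 100 :> R.
  by rewrite mulrAC (le_trans (ler_wpM2r _ ex)) //; lra.
have A0 : 0 <= expR 1 * (37 / 4 * 10 ^+ 3) :> R.
  by apply: mulr_ge0; [exact: expR_ge0|clear; lra].
have th1 : 57 / 100 <= 1 :> R by clear; lra.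
have := power_exponent_le d2 A0 th th1.
have e2 := @expRN2_le; have e20 := expR_ge0 (-2 : R).
set u := expR (- 2) in e2 e20 *.
set a := (expR 1 * _) ^+ d; set b := expR (- (2 * _ * _ * _)).
set g := expR (- _).
have g0 : 0 <= g by exact: expR_ge0.
move=> h; apply: (@le_trans _ _ (12 * (3 / 19) * (g * (57 / 100) ^+ 2)));
  last by clear - g0; lra.
rewrite -mulrA; apply: ler_pM => //.
- by rewrite mulr_ge0.
- by rewrite mulr_ge0 ?expR_ge0 // exprn_ge0.
- by clear -e2; lra.
Qed.

(** Bounding k + 2 by 2^(k+1) makes the net sizes geometric in [k]. *)
Lemma level_base_le k : level_base k.+1 <= 2 * 10 ^+ 9 * (2 * 10 ^+ 4) ^+ k.
Proof.
rewrite /level_base exprMn -exprM.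
have -> : (4 * k.+2 = 8 + 4 * k)%N by rewrite !mulnS addnA.
rewrite exprD; set T := 10 ^+ (4 * k); set K := 2 ^+ k.
have T1 : 1 <= T by rewrite exprn_ege1 //; lra.
have K1 : 1 <= K by rewrite exprn_ege1 //; lra.
have kK : k.+2%:R <= 2 * K.
  by rewrite /K -exprS -natrX ler_nat ltn_expl.
have KT : K <= K * T by rewrite ler_peMr //; lra.
have : k.+2%:R * (1 + 10 ^+ 8 * T) <= 2 * K * (1 + 10 ^+ 8 * T).
  by rewrite ler_wpM2r // addr_ge0 // mulr_ge0 ?exprn_ge0 //; lra.
move=> hv; rewrite -[_ * _ * (1 + _)]mulrA.
move: hv; set v := k.+2%:R * _ => hv; lra.
Qed.

Lemma level_base_ge0 k : 0 <= level_base k.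
Proof.
have h : 0 <= 1 + 10 ^+ (4 * k.+1) :> R.
  by rewrite addr_ge0 ?ler01 ?exprn_ge0 ?ler0n.
have h' : 0 <= 461 / 50 * k.+1%:R :> R by apply: mulr_ge0; [lra|exact: ler0n].
by apply: addr_ge0; [lra|exact: mulr_ge0].
Qed.

Lemma half_expn_itv k : 0 <= (1 / 2 : R) ^+ k <= 1.
Proof. by rewrite exprn_ge0 ?exprn_ile1 //; lra. Qed.

Lemma expR_ge_8e9 : 8 * 10 ^+ 9 <= expR (4587 / 200) :> R.
Proof.
have h219 : 8 <= expR (219 / 200 * 2) :> R.
  apply: (@expR_double_ge (29 / 10)); [lra|lra|].
  by apply: le_trans (expR_ge_cubic _); lra.
have -> : 4587 / 200 = 219 / 200 * 2 + 461 / 200 * 9 :> R by lra.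
by rewrite expRD ler_pM ?exprn_ge0 // expR_ge10X.
Qed.

Lemma expR26_ge : 4 * 10 ^+ 4 <= expR 26 :> R.
Proof.
apply: (@le_trans _ _ (10 ^+ 5)); first lra.
by apply: le_trans (expR_ge10X 5) _; rewrite ler_expR; lra.
Qed.

(** Replacing 400^k by 1 + 2 k bounds the exponent per dimension by -22.935 - 26 k. The factors 8 *
    10^9 and (4 * 10^4)^k gained this way exceed the net bound of [level_base_le] by 4 * 2^k, so
    theta = 2^(-k) / 4. *)
Lemma levelS_exponent (c : R) d k : (2 <= d)%N -> 2 + 4968 / 10 ^+ 4 < c ->
  4 * expR (- 2) * (expR 1 * level_base k.+1) ^+ d *
    expR (- (96 / 25 * 400 ^+ k * c ^+ 2 * d%:R)) <=
  expR (- ((kappa * c ^+ 2 - offset) * d%:R)) * (1 / 2) ^+ (k + 3).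
Proof.
move=> d2 hc; have c2 := sqr_threshold hc.
have m400 : 1 + 2 * k%:R <= 400 ^+ k :> R.
  elim: (k) => [|n IH]; first by rewrite mulr0 addr0 expr0.
  by rewrite exprS -natr1; have := ler0n R n; clear -IH; lra.
have e26k : (4 * 10 ^+ 4) ^+ k <= expR (26 * k%:R) :> R.
  have e26 := expR26_ge.
  by rewrite expRM_natr lerXn2r ?nnegrE ?expR_ge0 // mulr_ge0 ?exprn_ge0.
have p9 : 0 < 8 * 10 ^+ 9 :> R by rewrite mulr_gt0 ?exprn_gt0.
have p4 : 0 < (4 * 10 ^+ 4) ^+ k :> R by rewrite exprn_gt0 ?mulr_gt0 ?exprn_gt0.
have k0 := ler0n R k.
set u := 96 / 25 * 400 ^+ k * c ^+ 2.
have hu : 96 / 25 * (1 + 2 * k%:R) * c ^+ 2 <= u.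
  by rewrite /u ler_wpM2r ?sqr_ge0 // ler_wpM2l //; lra.
have hk : 6 * k%:R <= k%:R * c ^+ 2.
  by rewrite mulrC ler_wpM2l //; clear -c2; lra.
have ex : expR 1 * expR (kappa * c ^+ 2 - offset - u) <=
    (8 * 10 ^+ 9)^-1 * ((4 * 10 ^+ 4) ^+ k)^-1 :> R.
  apply: (@le_trans _ _ (expR (- (4587 / 200)) * expR (- (26 * k%:R)))).
    rewrite -!expRD ler_expR /kappa /offset.
    by clear -c2 hu hk k0; lra.
  apply: ler_pM; rewrite ?expR_ge0 // expRN lef_pV2 ?posrE ?expR_gt0 //.
  exact: expR_ge_8e9.
have th : expR 1 * level_base k.+1 * expR (kappa * c ^+ 2 - offset - u) <=
    1 / 4 * (1 / 2) ^+ k :> R.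
  rewrite mulrAC mulrC.
  apply: (le_trans (ler_pM (level_base_ge0 _) _ (level_base_le k) ex)).
    by rewrite mulr_ge0 ?expR_ge0.
  have -> : 4 * 10 ^+ 4 = 2 * (2 * 10 ^+ 4) :> R by ring.
  rewrite [(2 * (2 * 10 ^+ 4)) ^+ k]exprMn [1 / 2]div1r [2^-1 ^+ k]exprVn.
  set K := 2 ^+ k; set T := (2 * 10 ^+ 4) ^+ k.
  have K0 : 0 < K by rewrite exprn_gt0.
  have T0 : 0 < T by rewrite exprn_gt0 ?mulr_gt0 ?exprn_gt0.
  have -> : 2 * 10 ^+ 9 * T * ((8 * 10 ^+ 9)^-1 * (K * T)^-1) =
      1 / 4 * K^-1 :> R.
    by field; rewrite !gt_eqF.
  by [].
have /andP[h0 h1] := half_expn_itv k.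
have th1 : 1 / 4 * (1 / 2) ^+ k <= 1 :> R by clear -h0 h1; lra.
have A0 : 0 <= expR 1 * level_base k.+1.
  by apply: mulr_ge0; [exact: expR_ge0|exact: level_base_ge0].
have := power_exponent_le d2 A0 th th1.
have e2 := @expRN2_le; have e20 := expR_ge0 (-2 : R).
clear - h1 h0 e2 e20 A0; rewrite exprD; move: e2 e20 h1 h0.
set w := expR (- 2); set a := (expR 1 * _) ^+ d; set b := expR (- (u * _)).
set g := expR (- _); set v := (1 / 2) ^+ k => e2 e20 v1 v0.
have g0 : 0 <= g by exact: expR_ge0.
have ab0 : 0 <= a * b by rewrite mulr_ge0 ?expR_ge0 ?exprn_ge0.
move=> h; rewrite -mulrA.
apply: (@le_trans _ _ (12 / 19 * (g * (1 / 4 * v) ^+ 2))).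
  by apply: ler_pM => //; lra.
have : v ^+ 2 <= v by rewrite expr2 ler_piMr.
rewrite exprMn => vv.
have : g * v ^+ 2 <= g * v by rewrite ler_wpM2l.
by have := mulr_ge0 g0 v0; lra.
Qed.

End numerics.

(** * Chaining *)

Section chaining.
Context {R : realType} {disp : measure_display} {Omega : measurableType disp}.
Variable P : probability Omega R.

(** Failure is expressed by a measurable set outside which [good] holds, so that [good] itself need
    not define a measurable event. *)
Lemma seq_union_bound (T : eqType) (G : seq T) (good : T -> Omega -> Prop)
    (b : R) :
  (forall y, y \in G -> exists B, [/\ measurable B, (P B <= b%:E)%E &
    forall w, ~ B w -> good y w]) ->
  exists B, [/\ measurable B, (P B <= ((size G)%:R * b)%:E)%E &
    forall w, ~ B w -> forall y, y \in G -> good y w].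
Proof.
elim: G => [|y G IH] hG.
  by exists set0; split; rewrite ?mul0r ?measure0.
have [|B [mB PB hB]] := IH.
  by move=> z zG; apply: hG; rewrite inE zG orbT.
have [C [mC PC hC]] := hG y (mem_head _ _).
exists (C `|` B); split; first exact: measurableU.
  apply: (le_trans (measureU2 _ mC mB)).
  by rewrite /= -add1n natrD mulrDl mul1r EFinD leeD.
move=> w /not_orP[wC wB] z; rewrite inE => /orP[/eqP->|]; first exact: hC.
exact: hB.
Qed.

Variables (N d : nat) (gamma c : R) (X : {RV P >-> N.-tuple (d.-tuple R)}).
Hypotheses (N0 : (0 < N)%N) (d2 : (2 <= d)%N) (gamma0 : 0 <= gamma).
Hypotheses (hX : sampling_scheme X) (hn : D0_negatively_dependent X gamma).
Hypothesis hc : 2 + 4968 / 10 ^+ 4 < c.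

Let s : R := Num.sqrt (d%:R / N%:R).
Let failure : R := gamma * expR (- ((kappa * c ^+ 2 - offset) * d%:R)).

Lemma measurable_deviation (f : Omega -> R) (t : R) : measurable_fun setT f ->
  measurable [set w | t <= `|f w|].
Proof.
move=> mf; rewrite [X in measurable X](_ : _ =
    (fun w => `|f w|) @^-1` `[t, +oo[%classic).
  rewrite -[X in measurable X]setTI.
  have mn : measurable_fun setT (fun w => `|f w|) by exact: measurableT_comp.
  exact: mn.
by apply/seteqP; split => w /=; rewrite in_itv /= andbT.
Qed.

(** The partial sum .928 + .032 (1 + 1/5 + ... + 5^(-(k-1))) in closed form. *)
Definition chain_weight (k : nat) : R :=
  116 / 125 + 1 / 25 * (1 - (1 / 5) ^+ k).

(** The invariant of the chain. The share of the failure probability spent is 3/4 at the start, and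
    step [k] adds 2^(-(k+3)), so that the total stays below 1. *)
Let scaled k (tau : R) := exists G : seq (d.-tuple R), exists B : set Omega,
  [/\ forall y, y \in G -> cube tau y, covers G (level k) (cube tau),
      measurable B,
      (P B <= (failure * (1 - (1 / 2) ^+ (k + 2)))%:E)%E &
      forall w, ~ B w -> forall y, y \in G ->
        `|discrepancy X w y| <= chain_weight k * (c * s)].

Let Ns2 : N%:R * s ^+ 2 = d%:R.
Proof.
rewrite sqr_sqrtr ?divr_ge0 // mulrCA divff ?mulr1 //.
by rewrite pnatr_eq0 -lt0n.
Qed.

Let s0 : 0 <= s. Proof. exact: sqrtr_ge0. Qed.
Let c0 : 0 < c. Proof. by move: hc; lra. Qed.
Let d0 : (0 < d)%N. Proof. exact: ltnW. Qed.
Let cs0 : 0 <= c * s. Proof. by rewrite mulr_ge0 // ltW. Qed.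

Lemma chain0 tau : 0 <= tau < 1 -> scaled 0 tau.
Proof.
move=> t01; have /andP[_ t1] := t01.
have [G [cG sG vG]] := level0_cover d2 t01.
pose b : R := 2 * gamma * expR (- (2 * N%:R * (116 / 125 * (c * s)) ^+ 2)).
have t0 : 0 <= 116 / 125 * (c * s) by apply: mulr_ge0; [lra|exact: cs0].
have [|B [mB PB hB]] := @seq_union_bound _ G
  (fun y w => `|discrepancy X w y| <= 116 / 125 * (c * s)) b.
  move=> y yG.
  exists [set w | 116 / 125 * (c * s) <= `|discrepancy X w y|]; split.
  - by apply: measurable_deviation; exact: measurable_discrepancy.
  - apply: box_hoeffding => //.
    exact: cube_unit_cube (cG _ yG).
  - by move=> w /= /negP; rewrite -ltNge => /ltW.
exists G, B; split => //.
- apply: (le_trans PB); rewrite lee_fin.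
  have b0 : 0 <= b by rewrite !mulr_ge0 ?expR_ge0.
  apply: (le_trans (ler_wpM2r b0 sG)).
  have bE : 2 * N%:R * (116 / 125 * (c * s)) ^+ 2 =
      2 * (116 / 125) ^+ 2 * c ^+ 2 * d%:R.
    by rewrite -Ns2; ring.
  have := ler_wpM2l gamma0 (level0_exponent d2 hc).
  rewrite /b bE /failure.
  set e := (expR 1 * _) ^+ d; set f := expR (- (2 * _ * _ * _)).
  set g := expR (- _).
  have -> : 6 * expR (-2) * e * (2 * gamma * f) =
      gamma * (12 * expR (-2) * e * f) by ring.
  move=> h; apply: (le_trans h); rewrite mulrA.
  by have -> : 1 - (1 / 2) ^+ (0 + 2) = 3 / 4 :> R by rewrite add0n; field.
- move=> w Bw y yG; rewrite /chain_weight expr0 subrr mulr0 addr0.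
  exact: hB.
Qed.

(** Every point of the finer net has an upper neighbour in the coarser one, at volume distance at
    most [level k], and the Bernstein bound controls the difference. The hypothesis on [level k]
    ensures t <= [level k], which that bound requires. *)
Lemma chainS k tau : 0 <= tau < 1 -> 4 / 125 * (c * s) < level k ->
  scaled k tau -> scaled k.+1 tau.
Proof.
move=> t01 eta [G [B [cG vG mB PB hB]]]; have /andP[_ t1] := t01.
have [G' [cG' sG' vG']] := level_cover k.+1 d2 t01.
pose t : R := 4 / 125 * (1 / 5) ^+ k * (c * s).
pose b : R := 2 * gamma * expR (- (3 / 8 * N%:R * t ^+ 2 / level k)).
have five0 : 0 <= (1 / 5) ^+ k :> R by apply: exprn_ge0; lra.
have five1 : (1 / 5) ^+ k <= 1 :> R by apply: exprn_ile1; lra.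
have fcs : (1 / 5) ^+ k * (c * s) <= c * s by rewrite ler_piMl.
have tk : 0 <= t <= level k.
  rewrite /t -mulrA; apply/andP; split.
    by apply: mulr_ge0; [lra|rewrite mulr_ge0].
  lra.
have [|B' [mB' PB' hB']] := @seq_union_bound _ G'
  (fun z w => exists2 y, y \in G &
    `|discrepancy X w y - discrepancy X w z| <= t) b.
  move=> z zG; have [y [yG zy vy _]] := vG z (cG' z zG).
  exists [set w | t <= `|discrepancy X w y - discrepancy X w z|]; split.
  - apply: measurable_deviation; apply: measurable_funB;
      exact: measurable_discrepancy.
  - apply: box_bernstein => //.
    + exact: cube_unit_cube (cG' _ zG).
    + exact: cube_unit_cube (cG _ yG).
    + by rewrite lerBlDl.
    + exact: level_gt0.
  - by move=> w /= /negP; rewrite -ltNge => /ltW; exists y.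
exists G', (B `|` B'); split => //; first exact: measurableU.
- apply: (le_trans (measureU2 _ mB mB')).
  apply: (le_trans (leeD PB PB')); rewrite -EFinD lee_fin.
  have b0 : 0 <= b by rewrite !mulr_ge0 ?expR_ge0.
  (* 3/8 * .032^2 * 10^4 = 96/25, and the ratio 400 is 10^4 / 5^2. *)
  have bE : 3 / 8 * N%:R * t ^+ 2 / level k =
      96 / 25 * 400 ^+ k * c ^+ 2 * d%:R.
    have h400 : (400 : R) ^+ k = ((1 / 5) ^+ k) ^+ 2 * (10 ^+ 4) ^+ k.
      by rewrite -exprM mulnC exprM -exprMn; congr (_ ^+ k); lra.
    have lE : (level k)^-1 = 10 ^+ 4 * (10 ^+ 4) ^+ k :> R.
      by rewrite /level div1r exprVn invrK exprS.
    rewrite lE -Ns2 /t h400.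
    set F := (1 / 5) ^+ k; set T := (10 ^+ 4) ^+ k; by field.
  have := ler_wpM2l gamma0 (levelS_exponent k d2 hc).
  move: (ler_wpM2r b0 sG'); rewrite {2}/b bE /failure.
  set e := (expR 1 * _) ^+ d; set f := expR (- (96 / 25 * _ * _ * _)).
  set g := expR (- _) => h1 h2.
  have h3 : 2 * expR (-2) * e * (2 * gamma * f) =
    gamma * (4 * expR (-2) * e * f) by ring.
  rewrite h3 in h1; have := le_trans h1 h2.
  rewrite addSnnS !exprD; set v := (1 / 2) ^+ k.
  by move=> h4; lra.
- move=> w /not_orP[wB wB'] z zG.
  have [y yG yz] := hB' w wB' z zG.
  have hy := hB w wB y yG.
  have -> : discrepancy X w z =
    discrepancy X w y - (discrepancy X w y - discrepancy X w z) by ring.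
  apply: (le_trans (ler_normB _ _)); apply: (le_trans (lerD hy yz)).
  rewrite /chain_weight /t -mulrDl exprS le_eqVlt; apply/orP; left; apply/eqP.
  by congr (_ * _); field.
Qed.


Lemma chain (k : nat) tau : 0 <= tau < 1 ->
  (forall j, (j < k)%N -> 4 / 125 * (c * s) < level j) -> scaled k tau.
Proof.
move=> t01; elim: k => [|k IH] hk; first exact: chain0.
by apply: chainS => //; [exact: hk|apply: IH => j /ltnW jk; exact: hk].
Qed.

Lemma level_le_eventually (eta : R) : 0 < eta -> exists k, level k <= eta.
Proof.
move=> eta0; exists (Num.truncn eta^-1).
have h : eta^-1 < (Num.truncn eta^-1).+1%:R by rewrite truncnS_gt.
rewrite levelE -[leRHS]invrK lef_pV2 ?posrE ?invr_gt0 ?exprn_gt0 //.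
apply: (le_trans (ltW h)); rewrite -natrX ler_nat.
set m := (Num.truncn _).+1; apply: (@leq_trans (4 * m)).
  by rewrite leq_pmull.
exact/ltnW/ltn_expl.
Qed.

(* Both [frequency] and [volume] are monotone in the box, so a box is
   controlled by the bracketing pair of the last net up to its accuracy. *)
Lemma uniform_deviation tau : 0 <= tau < 1 -> exists B : set Omega,
  [/\ measurable B, (P B <= failure%:E)%E & forall w, ~ B w ->
    forall a, cube tau a -> `|discrepancy X w a| <= c * s].
Proof.
move=> t01.
have eta0 : 0 < 4 / 125 * (c * s).
  apply: mulr_gt0; [lra|apply: mulr_gt0 => //].
  by rewrite sqrtr_gt0 divr_gt0 ?ltr0n.
(* By minimality all earlier levels exceed .032 c s, as [chain] requires. *)
have [k hk kmin] := ex_minnP (level_le_eventually eta0).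
have hj j : (j < k)%N -> 4 / 125 * (c * s) < level j.
  by move=> jk; rewrite ltNge; apply/negP => /kmin; rewrite leqNgt jk.
have [G [B [cG vG mB PB hB]]] := chain t01 hj.
exists B; split => //.
  apply: (le_trans PB); rewrite lee_fin.
  have f0 : 0 <= failure by rewrite mulr_ge0 ?expR_ge0.
  by rewrite ler_piMr // gerBl exprn_ge0; lra.
move=> w Bw a ca; have hG := hB w Bw.
have wk : chain_weight k * (c * s) <= 121 / 125 * (c * s).
  rewrite ler_wpM2r // /chain_weight.
  have : 0 <= (1 / 5) ^+ k :> R by apply: exprn_ge0; lra.
  lra.
have [y [yG ay vy lo]] := vG a ca.
have := hG y yG; rewrite ler_norml => /andP[_ hy].
have fy := frequency_le (X w) ay.
have v0 := volume_ge0 ca.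
have f0 : 0 <= frequency (X w) (anchored_box a) by rewrite divr_ge0.
rewrite ler_norml; apply/andP; split; last first.
  by move: hy; rewrite /discrepancy; lra.
(* Without a lower neighbour, nonnegativity of the frequency gives a deviation of at least -
   [volume a], and this volume is within the accuracy. *)
case: lo => [va|[x [xG xa vx]]]; first by rewrite /discrepancy; lra.
have := hG x xG; rewrite ler_norml => /andP[hx _].
have fx := frequency_le (X w) xa.
by move: hx; rewrite /discrepancy; lra.
Qed.

End chaining.

(** * The star discrepancy as a countable supremum *)

Section approximation.
Context {R : realType} {d N : nat}.
Implicit Types (a : d.-tuple R) (p : N.-tuple (d.-tuple R)).

(** Telescoping: with factors in [0, 1], replacing one factor changes the product by at most the
    change of that factor. *)
Lemma prod_diff_le (I : eqType) (r : seq I) (f g : I -> R) :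
  (forall i, 0 <= g i <= f i) -> (forall i, f i <= 1) ->
  \prod_(i <- r) f i - \prod_(i <- r) g i <= \sum_(i <- r) (f i - g i).
Proof.
move=> gf f1; elim: r => [|i r IH]; first by rewrite !big_nil subrr.
rewrite !big_cons; have /andP[gi gfi] := gf i; have fi := f1 i.
set F := \prod_(j <- r) f j in IH *; set G := \prod_(j <- r) g j in IH *.
have GF : G <= F by apply: ler_prod.
have G1 : G <= 1.
  by apply: prodr_ile1 => j _; have /andP[-> /le_trans ->] := gf j.
have -> : f i * F - g i * G = f i * (F - G) + (f i - g i) * G by ring.
rewrite addrC lerD //; first by rewrite ler_piMr // subr_ge0.
by apply: le_trans IH; rewrite ler_piMl // subr_ge0.
Qed.

Definition of_rat (r : d.-tuple rat) : d.-tuple R := map_tuple ratr r.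

Lemma rat_box_approx p a (e : R) : cube 1 a -> 0 < e ->
  exists r, [/\ unit_cube (of_rat r), below (of_rat r) a,
    forall i, tnth a i - tnth (of_rat r) i <= e &
    forall j, anchored_box a (tnth p j) -> anchored_box (of_rat r) (tnth p j)].
Proof.
move=> ca e0.
have /choice[q hq] : forall i : 'I_d, exists q : rat,
    [/\ 0 <= (ratr q : R) < 1, ratr q <= tnth a i, tnth a i - ratr q <= e &
    forall j, 0 <= tnth (tnth p j) i < tnth a i -> tnth (tnth p j) i < ratr q].
  move=> i; have /andP[a0 a1] := ca i.
  (* No rational of [0, 1) lies strictly below 0, so a zero side is kept; no sample point has a
     coordinate in it. *)
  have [ai0|ai0] := eqVneq (tnth a i) 0.
    exists 0; rewrite ai0 rmorph0 lexx ltr01 subrr; split => // [|j].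
      exact: ltW.
    by case/andP.
  have {}ai0 : 0 < tnth a i by rewrite lt_neqAle eq_sym ai0.
  (* A rational strictly between [l] and the side keeps every sample coordinate lying below the
     side, so the smaller box loses no point. *)
  pose l := \big[Num.max/Num.max 0 (tnth a i - e)]_(j < N |
      tnth (tnth p j) i < tnth a i) tnth (tnth p j) i.
  have la : l < tnth a i.
    by apply: bigmax_lt => //; rewrite gt_max ai0 gtrBl.
  have [q] := rat_in_itvoo la; rewrite in_itv /= => /andP[lq qa].
  have l0 : Num.max 0 (tnth a i - e) <= l by exact: bigmax_ge_id.
  move: l0; rewrite ge_max => /andP[l0 le].
  exists q; split.
  - by rewrite (le_trans l0 (ltW lq)) (lt_le_trans qa).
  - exact: ltW.
  - by have := le_lt_trans le lq; lra.
  - move=> j /andP[_ pa]; apply: le_lt_trans lq.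
    by rewrite /l (bigmax_sup j).
exists [tuple q i | i < d].
have rE i : tnth (of_rat [tuple q i | i < d]) i = ratr (q i).
  by rewrite tnth_map tnth_mktuple.
split => [i|i|i|j pa i]; rewrite rE; have [h1 h2 h3 h4] := hq i => //.
by have /andP[p0 _] := pa i; rewrite p0 /= h4 // pa.
Qed.

(** Shrinking to the rational box leaves the frequency unchanged and moves the volume by less than
    the excess over [t]. *)
Lemma rat_deviation p a (t : R) : cube 1 a ->
  t < `|frequency p (anchored_box a) - volume a| ->
  exists r, unit_cube (of_rat r) /\
    t < `|frequency p (anchored_box (of_rat r)) - volume (of_rat r)|.
Proof.
move=> ca; rewrite -subr_gt0; set g := _ - t => g0.
(* Dividing by d + 1 rather than d makes the total error over the [d] sides strictly less than
   [g]. *)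
have e0 : 0 < g / d.+1%:R by rewrite divr_gt0.
have [r [ur ra re hit]] := rat_box_approx p ca e0.
exists r; split => //.
have -> : frequency p (anchored_box (of_rat r)) = frequency p (anchored_box a).
  apply/le_anti; rewrite frequency_le //= /frequency.
  rewrite ler_wpM2r ?invr_ge0 // ler_nat.
  apply: subset_leq_card; apply/fintype.subsetP => j; rewrite !inE => /hit.
  exact.
have vr : volume a - volume (of_rat r) < g.
  apply: (@le_lt_trans _ _ (\sum_(i < d) (tnth a i - tnth (of_rat r) i))).
    apply: prod_diff_le => i; last by case/andP: (ca i).
    by rewrite ra andbT; case/andP: (ur i).
  apply: (@le_lt_trans _ _ (\sum_(i < d) (g / d.+1%:R))).
    by apply: ler_sum => i _; exact: re.
  rewrite sumr_const card_ord -[ltLHS]mulr_natl mulrCA gtr_pMr //.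
  by rewrite ltr_pdivrMr // mul1r ltr_nat.
have vra : volume (of_rat r) <= volume a := le_volume (unit_cube_cube ur) ra.
rewrite /g in vr.
have -> : frequency p (anchored_box a) - volume (of_rat r) =
    (frequency p (anchored_box a) - volume a) -
    (volume (of_rat r) - volume a) by ring.
apply: lt_le_trans (lerB_dist _ _).
have neg : volume (of_rat r) - volume a <= 0 by rewrite subr_le0.
by rewrite (ler0_norm neg); lra.
Qed.

(** The real [sup] is a least upper bound only for a nonempty bounded set: the corner 0 gives an
    element, and 1 is a bound. *)
Lemma star_discrepancy_leP p (t : R) :
  star_discrepancy p <= t <->
  forall a, cube 1 a -> `|frequency p (anchored_box a) - volume a| <= t.
Proof.
have valE a : cube 1 a ->
    `|#|[pred j : 'I_N | tnth p j \in anchored_box a]|%:R / N%:R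
              - fine (lebesgue_tuple d (anchored_box a))| =
    `|frequency p (anchored_box a) - volume a|.
  by move=> ca; rewrite (lebesgue_anchored_box ca).
split => [pt a ca|h].
  apply: le_trans pt; rewrite -valE //; apply: ub_le_sup; last by exists a.
  exists 1 => _ [b cb <-]; rewrite valE //.
  have v0 := volume_ge0 cb; have v1 := volume_le1 cb.
  have f0 : 0 <= frequency p (anchored_box b) by rewrite divr_ge0.
  have f1 : frequency p (anchored_box b) <= 1.
    (* For N = 0 the frequency is 0, as division by 0 gives 0. *)
    rewrite /frequency; have [N0|N0] := posnP N.
      by rewrite [N%:R](_ : _ = 0) ?invr0 ?mulr0 ?N0.
    rewrite ler_pdivrMr ?ltr0n // mul1r ler_nat -[leqRHS](card_ord N).
    exact: max_card.
  by rewrite ler_norml; lra.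
apply: ge_sup.
  have c0 : cube 1 [tuple (0 : R) | _ < d].
    by move=> i; rewrite tnth_mktuple lexx ler01.
  by eexists; exists [tuple 0 | _ < d]; first exact: c0.
by move=> _ [b cb <-]; rewrite valE //; exact: h.
Qed.

End approximation.

(** * From deviations of boxes to the probability of a small star discrepancy *)

Section probability_bound.
Context {R : realType} {disp : measure_display} {Omega : measurableType disp}.
Variables (P : probability Omega R) (N d : nat).
Variable X : {RV P >-> N.-tuple (d.-tuple R)}.

(* Boxes touching the boundary [a_i = 1] are not in [anchored_boxes]; they are
   reached by letting the side bound [tau_ n] increase to 1. *)
Lemma star_discrepancy_tail (t b : R) :
  (forall tau, 0 <= tau < 1 -> exists B : set Omega,
    [/\ measurable B, (P B <= b%:E)%E & forall w, ~ B w ->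
      forall a, cube tau a -> `|discrepancy X w a| <= t]) ->
  ((1 - b)%:E <= P [set w | (star_discrepancy (X w) <= t)%R])%E.
Proof.
move=> hB.
pose tau_ n : R := 1 - n.+1%:R^-1.
have tau01 n : 0 <= tau_ n < 1.
  by rewrite subr_ge0 invf_le1 ?ltr0n // ler1n gtrBl invr_gt0 ltr0n.
(* Restricting to countably many rational corners makes the failure event measurable; each [F n]
   lies in an exceptional set given by [hB]. *)
pose F n : set Omega := \bigcup_(r in [set: d.-tuple rat])
  [set w | cube (tau_ n) (of_rat r) /\ t < `|discrepancy X w (of_rat r)|].
have mF n : measurable (F n).
  apply: countable_bigcupT_measurable => // r.
  have [cr|cr] := pselect (cube (tau_ n) (of_rat r : d.-tuple R)); last first.
    by rewrite (_ : [set w | _] = set0) //; apply/seteqP; split => // w [].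
  rewrite (_ : [set w | _] =
      (fun w => `|discrepancy X w (of_rat r)|) @^-1` `]t, +oo[%classic).
    rewrite -[X in measurable X]setTI.
    have mn : measurable_fun setT (fun w => `|discrepancy X w (of_rat r)|).
      by apply: measurableT_comp => //; exact: measurable_discrepancy.
    exact: mn.
  by apply/seteqP; split => w /=; rewrite in_itv /= andbT //; case.
have ndF : nondecreasing_seq F.
  move=> m n mn; apply/subsetPset => w [r _ [cr hr]].
  exists r => //; split => // i.
  case/andP: (cr i) => -> /le_trans -> //.
  by rewrite lerD2l lerN2 lef_pV2 ?posrE ?ltr0n // ler_nat.
have PF n : (P (F n) <= b%:E)%E.
  have [B [mB PB hBt]] := hB _ (tau01 n).
  apply: le_trans PB; apply: le_measure; rewrite ?inE //.
  move=> w [r _ [cr]]; rewrite ltNge => /negP hr; apply: contrapT => /hBt.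
  by move/(_ _ cr).
have mU : measurable (\bigcup_n F n) by exact: bigcupT_measurable.
have PU : (P (\bigcup_n F n) <= b%:E)%E.
  (* Continuity from below: the bound [b] survives the increasing union. *)
  have cv := nondecreasing_cvg_mu (mu := P) mF mU ndF.
  rewrite -(cvg_lim _ cv) //; apply: lime_le.
    by apply/cvg_ex; eexists; exact: cv.
  by near=> n; exact: PF.
have -> : [set w | star_discrepancy (X w) <= t] = ~` (\bigcup_n F n).
  apply/seteqP; split => [w /star_discrepancy_leP h|w hw] /=.
    move=> [n _ [r _ [cr]]]; rewrite ltNge => /negP; apply.
    apply: h => i; case/andP: (cr i) => -> /le_trans -> //.
    by case/andP: (tau01 n) => _ /ltW.
  apply/star_discrepancy_leP => a ca; rewrite leNgt; apply/negP => ha.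
  have [r [ur hr]] := rat_deviation ca ha; apply: hw.
  (* The finitely many sides of a rational box in [unit_cube] have a maximum below 1, hence below
     some [tau_ n]. *)
  pose m : R := \big[Num.max/0]_(i < d) tnth (of_rat r) i.
  have m1 : m < 1.
    by apply: bigmax_lt => // i _; case/andP: (ur i).
  have [n mn] : exists n, m <= tau_ n.
    exists (Num.truncn (1 - m)^-1).
    have h : (1 - m)^-1 < (Num.truncn (1 - m)^-1).+1%:R by rewrite truncnS_gt.
    rewrite /tau_ lerBrDl -lerBrDr -[leRHS]invrK.
    rewrite lef_pV2 ?posrE ?invr_gt0 ?subr_gt0 ?ltr0n //.
    exact: ltW.
  exists n => //; exists r => //; split => // i.
  case/andP: (ur i) => -> _ /=; apply: le_trans mn.
  exact: (le_bigmax _ (fun i => tnth (of_rat r) i)).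
by rewrite probability_setC // EFinB leeB.
Unshelve. all: by end_near. Qed.

End probability_bound.

(* The decimals are 2.4968, 1.67681, 10.45292 and 0.7723, cut into pieces of at
   most four digits because ring numerals are unary. *)
Theorem theorem3p5 (R : realType) (disp : measure_display)
    (Omega : measurableType disp) (P : probability Omega R)
    (d N : nat) (hd : (2 <= d)%N) (hN : (0 < N)%N)
    (rho : R) (hrho : 0 <= rho)
    (X : {RV P >-> N.-tuple (d.-tuple R)})
    (hX : sampling_scheme X)
    (hXneg : D0_negatively_dependent X (expR (rho * d%:R))) :
  (forall c : R, 2 + 4968 / 10 ^+ 4 < c ->
    ((1 - expR (- (((1 + 6768 / 10 ^+ 4 + 1 / 10 ^+ 5) * c ^+ 2
                    - (10 + 4529 / 10 ^+ 4 + 2 / 10 ^+ 5) - rho) * d%:R)))%:E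
     <= P [set w | (star_discrepancy (X w) <= c * Num.sqrt (d%:R / N%:R))%R])%E) /\
  (forall q : R, 0 < q < 1 ->
    (q%:E
     <= P [set w | (star_discrepancy (X w)
                   <= 7723 / 10 ^+ 4
                      * Num.sqrt (10 + 4529 / 10 ^+ 4 + 2 / 10 ^+ 5 + rho
                                  + ln ((1 - q)^-1) / d%:R)
                      * Num.sqrt (d%:R / N%:R))%R])%E).
Proof.
have tail (c : R) : 2 + 4968 / 10 ^+ 4 < c ->
    ((1 - expR (- ((kappa * c ^+ 2 - offset - rho) * d%:R)))%:E
     <= P [set w | (star_discrepancy (X w) <= c * Num.sqrt (d%:R / N%:R))%R])%E.
  move=> hc; apply: star_discrepancy_tail => tau t01.
  have := uniform_deviation hN hd (expR_ge0 _) hX hXneg hc t01.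
  (* The factor e^(rho d) of negative dependence merges into the exponent. *)
  rewrite -expRD [X in expR X](_ : _ =
    - ((kappa * c ^+ 2 - offset - rho) * d%:R)) //; ring.
split=> [c hc|q /andP[q0 q1]]; first exact: tail.
have d0 : (0 : R) < d%:R by rewrite ltr0n ltnW.
have lq : 0 <= ln ((1 - q)^-1).
  by rewrite ln_ge0 // invf_ge1 ?subr_gt0 // gerBl ltW.
have lqd : 0 <= ln ((1 - q)^-1) / d%:R by rewrite divr_ge0 // ltW.
rewrite -/offset; set L := offset + rho + _.
have L_ge : offset <= L by rewrite /L; lra.
have off0 : 0 <= offset :> R by rewrite /offset; lra.
have L0 : 0 <= L by exact: le_trans L_ge.
set c := 7723 / 10 ^+ 4 * Num.sqrt L.
have c0 : 0 <= c by apply: mulr_ge0; [lra|exact: sqrtr_ge0].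
have c2 : c ^+ 2 = (7723 / 10 ^+ 4) ^+ 2 * L by rewrite exprMn sqr_sqrtr.
have lt_sqr (x y : R) : 0 <= y -> x ^+ 2 < y ^+ 2 -> x < y.
  move=> y0; apply: contraTT; rewrite -!leNgt => yx.
  by rewrite lerXn2r ?nnegrE // (le_trans y0).
have hc : 2 + 4968 / 10 ^+ 4 < c.
  (* L >= [offset] suffices, because .7723^2 * 10.45292 > 2.4968^2. *)
  apply: lt_sqr c0 _; rewrite c2.
  apply: (@lt_le_trans _ _ ((7723 / 10 ^+ 4) ^+ 2 * offset)).
    by rewrite /offset; lra.
  by apply: ler_wpM2l L_ge; apply: exprn_ge0; lra.
apply: le_trans (tail _ hc); rewrite lee_fin lerBrDl -lerBrDr.
have q1' : 0 < 1 - q by rewrite subr_gt0.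
rewrite -[leRHS]lnK ?posrE // ler_expR lerNl -lnV ?posrE // -ler_pdivrMr //.
(* .7723^2 * 1.67681 exceeds 1 by about 10^(-4), so that [kappa] c^2 >= L, and subtracting [offset]
   and [rho] from L leaves the logarithmic term. *)
have : 1 * L <= (kappa * (7723 / 10 ^+ 4) ^+ 2) * L.
  by apply: ler_wpM2r; [exact: L0|rewrite /kappa; lra].
by rewrite c2 /L; lra.
Qed.
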